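(* Let $\mathcal{E}$ be an ellipse in the Euclidean plane and fix an angle $\theta$ between $0$ and $\pi$. For each point $M$ on $\mathcal{E}$ let $K=K(M,\theta)$ be the center of the Frégier ellipse $\mathcal{E}'=\mathcal{E}'_{M,\theta}$. Then, as $M$ varies on $\mathcal{E}$, the locus of $K$ is an ellipse concentric with $\mathcal{E}$.
   Context: For a point $M$ on $\mathcal{E}$ and an angle $\theta$ between $0$ and $\pi$, consider the triangles $MNL$ inscribed in $\mathcal{E}$ whose internal angle at $M$ equals $\theta$. The envelope of the chords $NL$ is included in an ellipse, denoted $\mathcal{E}'_{M,\theta}$ and called the Frégier ellipse of $(M,\theta)$. For $\theta=\pi/2$ it degenerates to a single point $K$ (the $M$-Frégier point), through which all the chords $NL$ pass.
   Formalization: If the ellipse is a circle, symmetry makes K its center for every M, so the locus is a single point and not an ellipse; the formal theorem asserts a concentric ellipse when the given ellipse is not a circle, and that the locus is exactly the center when it is a circle. *)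

(* Defs.v *)
From HB Require Import structures.
From mathcomp Require Import all_boot all_order all_algebra.
From mathcomp Require Import all_classical all_reals all_analysis.

Set Implicit Arguments.
Unset Strict Implicit.
Unset Printing Implicit Defensive.

Import Order.TTheory GRing.Theory Num.Theory.
Import numFieldNormedType.Exports.

Local Open Scope classical_set_scope.
Local Open Scope ring_scope.

(* The Euclidean plane is R * R.  The library norm on a product is the max
   norm, so the Euclidean one is introduced separately; both give the same
   neighbourhoods. *)
Definition dot (R : realType) (u v : R * R) : R := u.1 * v.1 + u.2 * v.2.

Definition enorm (R : realType) (u : R * R) : R := Num.sqrt (dot u u).

Definition rot90 (R : realType) (u : R * R) : R * R := (- u.2, u.1).

(* Meaningful only when N and L both differ from M. *)
Definition angle (R : realType) (N M L : R * R) : R :=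
  acos (dot (N - M) (L - M) / (enorm (N - M) * enorm (L - M))).

(* S is an ellipse with centre C: in the orthonormal frame (C; u, rot90 u) it
   has equation x^2/a^2 + y^2/b^2 = 1.  Circles (a = b) are included. *)
Definition ellipse_at (R : realType) (C : R * R) (S : set (R * R)) : Prop :=
  exists (u : R * R) (a b : R),
    [/\ dot u u = 1, 0 < a, 0 < b &
        S = [set P | (dot (P - C) u / a) ^+ 2
                     + (dot (P - C) (rot90 u) / b) ^+ 2 = 1]].

Definition circle_at (R : realType) (C : R * R) (S : set (R * R)) : Prop :=
  exists2 r : R, 0 < r & S = [set P | enorm (P - C) = r].

Definition segment (R : realType) (c : (R * R) * (R * R)) : set (R * R) :=
  [set P | exists2 t : R, 0 <= t <= 1 & P = (1 - t) *: c.1 + t *: c.2].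

(* The pairs (N, L) such that MNL is a triangle inscribed in E with internal
   angle theta at M.  For 0 < theta < pi the points M, N, L are automatically
   non-collinear. *)
Definition chords (R : realType) (E : set (R * R)) (M : R * R) (theta : R) :
    set ((R * R) * (R * R)) :=
  [set c | [/\ E c.1, E c.2, c.1 != M, c.2 != M & angle c.1 M c.2 = theta]].

(* Envelope of a family of segments, as the set of limit positions of the
   intersection of a member c with a neighbouring member c' as c' tends to c.
   The limit_point clause excludes isolated members, for which the limit
   condition would be vacuous. *)
Definition envelope (R : realType) (F : set ((R * R) * (R * R))) :
    set (R * R) :=
  [set P | exists c, [/\ F c, limit_point F c &
     forall U, nbhs P U ->
       \forall c' \near c, F c' -> c' != c ->
         exists Q, [/\ U Q, segment c Q & segment c' Q]]].

(* S is the Fregier ellipse of (M, theta) with respect to E, and K its centre.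
   For theta = pi / 2 it is the degenerate ellipse reduced to the point K
   through which all the chords pass. *)
Definition fregier_ellipse (R : realType) (E : set (R * R)) (M : R * R)
    (theta : R) (K : R * R) (S : set (R * R)) : Prop :=
  if theta == pi / 2 then
    S = [set K] /\ (forall c, chords E M theta c -> segment c K)
  else
    ellipse_at K S /\ envelope (chords E M theta) `<=` S.

Definition fregier_center (R : realType) (E : set (R * R)) (M : R * R)
    (theta : R) (K : R * R) : Prop :=
  exists S, fregier_ellipse E M theta K S.

Definition fregier_center_locus (R : realType) (E : set (R * R)) (theta : R) :
    set (R * R) :=
  [set K | exists2 M, E M & fregier_center E M theta K].

(* Main.v *)
(* Through a point M of the ellipse E, take coordinates (x, y) along the tangent
   and the inner normal at M; then E is x^2 + y^2 = 2 y w with w affine and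
   positive on E.  With v = w - y this reads x^2 + v^2 = w^2: the projective map
   (x, v) / w keeps every line through M and turns E into the unit circle.  By
   the inscribed angle theorem the chords seen from M under the angle theta
   become chords at distance |cos theta| from the centre, i.e. the lines
   x e_1 + v e_2 = w cos theta, with e a unit vector such that e_2 < cos theta.
   Their envelope lies on the conic x^2 + v^2 = cos^2(theta) w^2 and contains an
   arc of it, so that it determines this conic, hence its centre.
   In the axes of E, with M = (a m, b n), k = b/a, s = k + 1/k and d = k - 1/k,
   one finds w = (s + d (m X/a - n Y/b)) / 2, so that the conic is
   X^2/a^2 + Y^2/b^2 - 1 + sin^2(theta) w^2 = 0, with centre
   r (a m, - b n) for r = - sin^2(theta) s d / (4 + sin^2(theta) d^2). *)
Require Import Defs.
From mathcomp Require Import all_boot all_order all_algebra.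
From mathcomp Require Import all_classical all_reals all_analysis.
From mathcomp Require Import ring lra.

Set Implicit Arguments.
Unset Strict Implicit.
Unset Printing Implicit Defensive.

Import Order.TTheory GRing.Theory Num.Theory.
Import numFieldNormedType.Exports.

Local Open Scope classical_set_scope.
Local Open Scope ring_scope.

(** * Chords of the unit circle *)

Definition unitv {R : realType} (v : R * R) : Prop := v.1 ^+ 2 + v.2 ^+ 2 = 1.

(* For c^2 + s^2 = 1, the points [endp c s e] and [endp c (- s) e] are the ends
   of the chord of the unit circle with unit normal e at signed distance c. *)
Definition endp {R : realType} (c s : R) (e : R * R) : R * R :=
  (c * e.1 - s * e.2, c * e.2 + s * e.1).

Lemma unitv_endp {R : realType} (c s : R) (e : R * R) :
  c ^+ 2 + s ^+ 2 = 1 -> unitv e -> unitv (endp c s e).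
Proof.
rewrite /unitv /= => cs ue.
have -> : (c * e.1 - s * e.2) ^+ 2 + (c * e.2 + s * e.1) ^+ 2 =
  (c ^+ 2 + s ^+ 2) * (e.1 ^+ 2 + e.2 ^+ 2) by ring.
by rewrite cs ue mul1r.
Qed.

Lemma unitv_snd_lt1 {R : realType} (v : R * R) :
  unitv v -> v != (0, 1) -> v.2 < 1.
Proof.
case: v => v1 v2; rewrite /unitv /= => uv; apply: contraNT; rewrite -leNgt => h.
have e1 : v1 ^+ 2 = 0 by have := sqr_ge0 v1; nra.
have e2 : v2 = 1 by rewrite e1 in uv; nra.
by move/eqP: e1; rewrite sqrf_eq0 => /eqP ->; rewrite e2.
Qed.

(** Since [(s, c)] and [e] are unit vectors, twice [1 - (endp c s e).2] is their squared distance,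
    which is positive because [e.2 < c]. *)
Lemma endp_snd_lt1 {R : realType} (c s : R) (e : R * R) :
  c ^+ 2 + s ^+ 2 = 1 -> unitv e -> e.2 < c -> (endp c s e).2 < 1.
Proof.
rewrite /unitv /= => cs ue lt.
have := sqr_ge0 (e.1 - s).
have : 0 < (c - e.2) ^+ 2 by rewrite exprn_gt0// subr_gt0.
nra.
Qed.

(* Half-angle formulas: if v = (sin 2f, cos 2f) and v' = (sin 2g, cos 2g) with
   f, g in ]0, pi[, then r = 2 sin f sin g, c = cos (f - g) and
   e = (sin (f + g), cos (f + g)). *)
Lemma inscribed_endp {R : realType} (c s r : R) (v v' : R * R) :
  c ^+ 2 + s ^+ 2 = 1 -> unitv v -> unitv v' ->
  0 < r -> r ^+ 2 = (1 - v.2) * (1 - v'.2) ->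
  v.1 * v'.1 + (1 - v.2) * (1 - v'.2) = 2 * c * r ->
  exists e t, [/\ unitv e, e.2 < c, t = s \/ t = - s,
    v = endp c t e & v' = endp c (- t) e].
Proof.
case: v v' => [x v2] [x' v2']; rewrite /unitv /= => cs uv uv' r0.
set y := 1 - v2; set y' := 1 - v2' => r2 hX.
have Ey : v2 = 1 - y by rewrite /y; ring.
have Ey' : v2' = 1 - y' by rewrite /y'; ring.
have r0' : r != 0 by rewrite gt_eqF.
have /andP[y0 y0'] : (y != 0) && (y' != 0).
  by rewrite -negb_or -mulf_eq0 -r2 sqrf_eq0.
have n0 : (2 * r) ^+ 2 != 0 by rewrite sqrf_eq0 mulf_neq0// pnatr_eq0.
have hy : x ^+ 2 + y ^+ 2 = 2 * y by rewrite Ey in uv; lra.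
have hy' : x' ^+ 2 + y' ^+ 2 = 2 * y' by rewrite Ey' in uv'; lra.
have hc : c = (x * x' + y * y') / (2 * r) by rewrite hX; field.
have hcr : c - r = (x * x' - y * y') / (2 * r).
  have -> : c - r = (x * x' + y * y' - 2 * r ^+ 2) / (2 * r) by rewrite hc; field.
  by rewrite r2; congr (_ / _); ring.
have h4 : (x ^+ 2 + y ^+ 2) * (x' ^+ 2 + y' ^+ 2) = (2 * r) ^+ 2.
  by rewrite hy hy' exprMn r2; ring.
(* In the half-angle notation [x = 2 sin f cos f] and [y = 2 sin^2 f], so the witnesses are
   [(sin (f + g), cos (f + g))] and [sin (g - f)]. *)
exists ((x * y' + x' * y) / (2 * r), c - r), ((x * y' - x' * y) / (2 * r)).
split => /=.
- have num : (x * y' + x' * y) ^+ 2 + (x * x' - y * y') ^+ 2 = (2 * r) ^+ 2.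
    by rewrite -h4; ring.
  by rewrite hcr !expr_div_n -mulrDl num divff.
- by rewrite ltrBlDr ltrDl.
- have : ((x * y' - x' * y) / (2 * r)) ^+ 2 = s ^+ 2.
    have -> : s ^+ 2 = 1 - c ^+ 2 by rewrite -cs; ring.
    have num : (x * y' - x' * y) ^+ 2 = (2 * r) ^+ 2 - (x * x' + y * y') ^+ 2.
      by rewrite -h4; ring.
    by rewrite hc !expr_div_n num mulrBl divff.
  by move/eqP; rewrite eqf_sqr => /orP[]/eqP; [left|right].
- rewrite /endp /= hcr hc; congr pair.
    transitivity (x * y * (x' ^+ 2 + y' ^+ 2) * 2 / (2 * r) ^+ 2).
      by rewrite hy' exprMn r2; field; rewrite ?y0 ?y0'.
    by field.
  rewrite Ey; transitivity (1 - y * y * (x' ^+ 2 + y' ^+ 2) * 2 / (2 * r) ^+ 2).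
    by rewrite hy' exprMn r2; field; rewrite ?y0 ?y0'.
  by rewrite -[X in X - _](divff n0) -[X in X / _ - _]h4; field; rewrite ?r0'.
- rewrite /endp /= hcr hc; congr pair.
    transitivity (x' * y' * (x ^+ 2 + y ^+ 2) * 2 / (2 * r) ^+ 2).
      by rewrite hy exprMn r2; field; rewrite ?y0 ?y0'.
    by field.
  rewrite Ey'; transitivity (1 - y' * y' * (x ^+ 2 + y ^+ 2) * 2 / (2 * r) ^+ 2).
    by rewrite hy exprMn r2; field; rewrite ?y0 ?y0'.
  by rewrite -[X in X - _](divff n0) -[X in X / _ - _]h4; field; rewrite ?r0'.
Qed.

(** * Quartics and quadratic forms *)

Lemma quartic_eq0 {R : realType} (t p0 p1 p2 p3 p4 : R) : t != 0 ->
  (forall x, x \in [:: 0; t; - t; 2 * t; - (2 * t)] ->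
     p0 + p1 * x + p2 * x ^+ 2 + p3 * x ^+ 3 + p4 * x ^+ 4 = 0) ->
  [/\ p0 = 0, p1 = 0, p2 = 0, p3 = 0 & p4 = 0].
Proof.
move=> t0 H.
have h0 := H 0; have h1 := H t; have h2 := H (- t); have h3 := H (2 * t).
have h4 := H (- (2 * t)); rewrite !inE !eqxx ?orbT in h0 h1 h2 h3 h4.
move: {H} (h0 isT) (h1 isT) (h2 isT) (h3 isT) (h4 isT) => {h0 h1 h2 h3 h4} h0 h1 h2 h3 h4.
have p00 : p0 = 0 by rewrite -h0; ring.
have eq0 k n (q : R) : k%:R * q * t ^+ n = 0 -> (0 < k)%N -> q = 0.
  move=> /eqP + k0; rewrite !mulf_eq0 pnatr_eq0 expf_eq0 (negbTE t0) andbF orbF.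
  by rewrite -leqn0 leqNgt k0 /= => /eqP.
(* The fourth central difference with step [t] leaves only [24 p4 t^4]; the third difference below
   leaves [12 p3 t^3]. *)
have p40 : p4 = 0.
  apply: (eq0 24%N 4%N) => //.
  transitivity ((p0 + p1 * (2 * t) + p2 * (2 * t) ^+ 2 + p3 * (2 * t) ^+ 3 + p4 * (2 * t) ^+ 4)
   + (p0 + p1 * - (2 * t) + p2 * (- (2 * t)) ^+ 2 + p3 * (- (2 * t)) ^+ 3 + p4 * (- (2 * t)) ^+ 4)
   - 4 * (p0 + p1 * t + p2 * t ^+ 2 + p3 * t ^+ 3 + p4 * t ^+ 4)
   - 4 * (p0 + p1 * - t + p2 * (- t) ^+ 2 + p3 * (- t) ^+ 3 + p4 * (- t) ^+ 4) + 6 * p0).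
    by ring.
  by rewrite h1 h2 h3 h4 p00; ring.
have p30 : p3 = 0.
  apply: (eq0 12%N 3%N) => //.
  transitivity ((p0 + p1 * (2 * t) + p2 * (2 * t) ^+ 2 + p3 * (2 * t) ^+ 3 + p4 * (2 * t) ^+ 4)
   - (p0 + p1 * - (2 * t) + p2 * (- (2 * t)) ^+ 2 + p3 * (- (2 * t)) ^+ 3 + p4 * (- (2 * t)) ^+ 4)
   - 2 * (p0 + p1 * t + p2 * t ^+ 2 + p3 * t ^+ 3 + p4 * t ^+ 4)
   + 2 * (p0 + p1 * - t + p2 * (- t) ^+ 2 + p3 * (- t) ^+ 3 + p4 * (- t) ^+ 4)).
    by ring.
  by rewrite h1 h2 h3 h4; ring.
rewrite p00 p30 p40 in h1 h2 *.
split => //.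
  apply: (eq0 2%N 1%N) => //.
  transitivity ((0 + p1 * t + p2 * t ^+ 2 + 0 * t ^+ 3 + 0 * t ^+ 4)
    - (0 + p1 * - t + p2 * (- t) ^+ 2 + 0 * (- t) ^+ 3 + 0 * (- t) ^+ 4)); first by ring.
  by rewrite h1 h2; ring.
apply: (eq0 2%N 2%N) => //.
transitivity ((0 + p1 * t + p2 * t ^+ 2 + 0 * t ^+ 3 + 0 * t ^+ 4)
  + (0 + p1 * - t + p2 * (- t) ^+ 2 + 0 * (- t) ^+ 3 + 0 * (- t) ^+ 4)); first by ring.
by rewrite h1 h2; ring.
Qed.

(* Five points of the arc suffice: those of rational parameter x = 0, t, -t, 2t,
   -2t under (2x, x^2 - 1) / (1 + x^2), with t small. *)
Lemma quad_form_arc {R : realType} (c A1 A2 A3 A4 A5 A6 : R) : c != 0 -> -1 < c ->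
  (forall e : R * R, unitv e -> e.2 < c ->
     A1 * (c * e.1) ^+ 2 + A2 * (c * e.1) * (c * e.2) + A3 * (c * e.2) ^+ 2
     + A4 * (c * e.1) + A5 * (c * e.2) + A6 = 0) ->
  [/\ A2 = 0, A4 = 0, A5 = 0, A3 = A1 & A6 = - (A1 * c ^+ 2)].
Proof.
move=> c0 c1 H.
(* The parametrized point has second coordinate below [c] exactly when [x^2 (1 - c) < 1 + c]; this
   [t] ensures it up to [|x| = 2 t]. *)
pose t := Num.min (2^-1 : R) ((1 + c) / 4).
have t0 : 0 < t by rewrite lt_min invr_gt0 ltr0n /= divr_gt0// -ltrBlDl sub0r.
have t1 : t <= 1 / 2 by rewrite mul1r ge_min lexx.
have t2 : t <= (1 + c) / 4 by rewrite ge_min lexx orbT.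
have ht : (2 * t) ^+ 2 * (1 - c) < 1 + c by nra.
have hx x : x ^+ 2 <= (2 * t) ^+ 2 ->
    (A3 * c ^+ 2 - A5 * c + A6) + (2 * A4 * c - 2 * A2 * c ^+ 2) * x
    + (4 * A1 * c ^+ 2 - 2 * A3 * c ^+ 2 + 2 * A6) * x ^+ 2
    + (2 * A4 * c + 2 * A2 * c ^+ 2) * x ^+ 3
    + (A3 * c ^+ 2 + A5 * c + A6) * x ^+ 4 = 0.
  move=> xt; have x20 := sqr_ge0 x.
  have d0 : 0 < 1 + x ^+ 2 by lra.
  have dn := lt0r_neq0 d0.
  have ux : unitv (2 * x / (1 + x ^+ 2), (x ^+ 2 - 1) / (1 + x ^+ 2)).
    by rewrite /unitv /=; field.
  have lx : (x ^+ 2 - 1) / (1 + x ^+ 2) < c by rewrite ltr_pdivrMr//; nra.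
  rewrite -(mulr0 ((1 + x ^+ 2) ^+ 2)) -(H _ ux lx) /=.
  by field.
have tn := lt0r_neq0 t0.
have ht5 x : x \in [:: 0; t; - t; 2 * t; - (2 * t)] -> x ^+ 2 <= (2 * t) ^+ 2.
  rewrite !inE; have tt := sqr_ge0 t.
  by case/or4P => [| | |/orP[]] /eqP ->; rewrite ?sqrrN ?expr0n /= ?exprMn; lra.
have [e0 e1 e2 e3 e4] := quartic_eq0 tn (fun x hin => hx x (ht5 x hin)).
have c2 : c ^+ 2 != 0 by rewrite expf_neq0.
have a2 : A2 = 0 by apply: (mulIf c2); lra.
have a4 : A4 = 0 by apply: (mulIf c0); lra.
have a5 : A5 = 0 by apply: (mulIf c0); lra.
have a3 : A3 = A1 by apply: (mulIf c2); lra.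
by split => //; lra.
Qed.

(** Spectral theorem in dimension two. For [be != 0] the vector [(be, d)] is an eigenvector for the
    larger eigenvalue [al + d]; the other eigenvalue [ga - d] is positive because the determinant
    is. *)
Lemma diag_quad {R : realType} (al be ga : R) : 0 < al -> be ^+ 2 < al * ga ->
  exists cs sn l1 l2 : R, [/\ cs ^+ 2 + sn ^+ 2 = 1, 0 < l1, 0 < l2 &
    forall X Y, al * X ^+ 2 + 2 * be * (X * Y) + ga * Y ^+ 2 =
      l1 * (cs * X + sn * Y) ^+ 2 + l2 * (cs * Y - sn * X) ^+ 2].
Proof.
move=> al0 disc; have be20 := sqr_ge0 be.
have ga0 : 0 < ga by rewrite -(pmulr_rgt0 _ al0); apply: le_lt_trans disc.
(* The case [be = 0] is treated apart because [(be, d)] may then vanish; the form is already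
   diagonal. *)
have [be0|ben] := eqVneq be 0.
  exists 1, 0, al, ga; split => //; first by rewrite expr1n expr0n addr0.
  by move=> X Y; rewrite be0; ring.
pose r := Num.sqrt (((al - ga) / 2) ^+ 2 + be ^+ 2).
have r2 : r ^+ 2 = ((al - ga) / 2) ^+ 2 + be ^+ 2.
  by rewrite sqr_sqrtr// addr_ge0// sqr_ge0.
have r0 : 0 <= r by exact: sqrtr_ge0.
pose d := (ga - al) / 2 + r.
have hd : be ^+ 2 = d * (d + al - ga).
  by rewrite /d; transitivity (r ^+ 2 - ((al - ga) / 2) ^+ 2); [rewrite r2; ring|field].
have l1l2 : (al + d) * (ga - d) = al * ga - be ^+ 2 by rewrite hd; ring.
have l1 : 0 < al + d by rewrite /d; lra.
have l2 : 0 < ga - d by rewrite -(pmulr_rgt0 _ l1) l1l2 subr_gt0.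
have n0 : 0 < be ^+ 2 + d ^+ 2.
  by rewrite ltr_pwDl ?sqr_ge0// exprn_even_gt0.
pose k := Num.sqrt (be ^+ 2 + d ^+ 2).
have k2 : k ^+ 2 = be ^+ 2 + d ^+ 2 by rewrite sqr_sqrtr// ltW.
have k0 : k != 0 by rewrite gt_eqF// sqrtr_gt0.
exists (be / k), (d / k), (al + d), (ga - d); split => //.
  by rewrite !expr_div_n -mulrDl -k2 divff// expf_neq0.
move=> X Y.
have k20 : k ^+ 2 != 0 by rewrite expf_neq0.
transitivity (((al + d) * (be * X + d * Y) ^+ 2 + (ga - d) * (be * Y - d * X) ^+ 2)
   / k ^+ 2); last by field.
apply: (canRL (mulfK k20)); rewrite k2.
apply/eqP; rewrite -subr_eq0; apply/eqP.
transitivity ((be ^+ 2 - d * (d + al - ga)) *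
  ((2 * be * X * Y - d * X ^+ 2 + d * Y ^+ 2))); last by rewrite -hd subrr mul0r.
by ring.
Qed.

(** The axes of the Fregier ellipse are in general oblique to those of [E]: the frame [u] is rotated
    onto the eigenvectors of the form. *)
Lemma quad_ellipse {R : realType} (u K : R * R) (al be ga k : R) :
  dot u u = 1 -> 0 < al -> be ^+ 2 < al * ga -> 0 < k ->
  ellipse_at K [set P | al * dot (P - K) u ^+ 2
    + 2 * be * (dot (P - K) u * dot (P - K) (rot90 u))
    + ga * dot (P - K) (rot90 u) ^+ 2 = k].
Proof.
move=> uu al0 disc k0.
have [cs [sn [l1 [l2 [csn l10 l20 H]]]]] := diag_quad al0 disc.
exists (cs * u.1 - sn * u.2, cs * u.2 + sn * u.1), (Num.sqrt (k / l1)), (Num.sqrt (k / l2)).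
split; rewrite ?sqrtr_gt0 ?divr_gt0//.
  transitivity ((cs ^+ 2 + sn ^+ 2) * dot u u); first by rewrite /dot /=; ring.
  by rewrite csn uu mul1r.
apply/seteqP; split => P /=; rewrite H !expr_div_n !sqr_sqrtr ?divr_ge0 ?ltW//;
  set X := dot _ u; set Y := dot _ (rot90 u).
all: have -> : dot (P - K) (cs * u.1 - sn * u.2, cs * u.2 + sn * u.1) = cs * X + sn * Y
  by rewrite /X /Y /dot /=; ring.
all: have -> : dot (P - K) (rot90 (cs * u.1 - sn * u.2, cs * u.2 + sn * u.1)) =
  cs * Y - sn * X by rewrite /X /Y /dot /=; ring.
all: have kn := lt0r_neq0 k0; have l1n := lt0r_neq0 l10; have l2n := lt0r_neq0 l20.
  by move=> E; rewrite -[RHS](divff kn) -[X in _ = X / _]E; field; rewrite kn l1n l2n.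
move=> E; rewrite -[RHS]mulr1 -[X in _ = _ * X]E; field.
by rewrite kn l1n l2n.
Qed.

(** * The chart of an ellipse at one of its points *)

Section TangentFrame.
Context {R : realType} (M tau : R * R) (p B h : R).
Hypotheses (tau_gt0 : 0 < dot tau tau) (p_gt0 : 0 < p)
  (B_lt : B ^+ 2 < 1 + 2 * h).

(** The vector [tau] is not normalized: dividing by [dot tau tau] gives the coordinates in the basis
    [tau], [rot90 tau] and avoids square roots. *)
Definition frx (P : R * R) : R := dot (P - M) tau / dot tau tau.
Definition fry (P : R * R) : R := dot (P - M) (rot90 tau) / dot tau tau.
Definition frpt (x y : R) : R * R :=
  (M.1 + x * tau.1 - y * tau.2, M.2 + x * tau.2 + y * tau.1).
Definition frw (P : R * R) : R := p - B * frx P - h * fry P.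
Definition frv (P : R * R) : R := frw P - fry P.
(** Expanded, the equation is [x^2 + 2 B x y + (1 + 2 h) y^2 = 2 p y]: a conic tangent to [tau] at
    [M], and [B_lt] makes it an ellipse. *)
Definition frE : set (R * R) :=
  [set P | frx P ^+ 2 + frv P ^+ 2 = frw P ^+ 2].
(* [chart] is the inverse of [prj], which sends [frE] to the unit circle, [M] to
   (0, 1), and lines through [M] to lines through (0, 1). *)
Definition den (q : R * R) : R := 1 + h + B * q.1 - h * q.2.
Definition chart (q : R * R) : R * R :=
  frpt (q.1 * (p / den q)) ((1 - q.2) * (p / den q)).
Definition prj (P : R * R) : R * R := (frx P / frw P, frv P / frw P).

Lemma frxK x y : frx (frpt x y) = x.
Proof using tau_gt0.
have := lt0r_neq0 tau_gt0.
by rewrite /frx /dot /= => h0; field.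
Qed.

Lemma fryK x y : fry (frpt x y) = y.
Proof using tau_gt0.
have := lt0r_neq0 tau_gt0.
by rewrite /fry /dot /= => h0; field.
Qed.

Lemma frptK P : frpt (frx P) (fry P) = P.
Proof using tau_gt0.
have := lt0r_neq0 tau_gt0.
by case: P => P1 P2; rewrite /frpt /frx /fry /dot /= => h0; congr pair; field.
Qed.

Lemma frpt_inj P Q : frx P = frx Q -> fry P = fry Q -> P = Q.
Proof using tau_gt0. by move=> e1 e2; rewrite -(frptK P) -(frptK Q) e1 e2. Qed.

(** By Cauchy-Schwarz [(B q.1 - h q.2)^2 <= B^2 + h^2], and [B_lt] bounds this by [(1 + h)^2]. The
    line that [chart] sends to infinity thus misses the closed disc. *)
Lemma den_gt0 q : q.1 ^+ 2 + q.2 ^+ 2 <= 1 -> 0 < den q.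
Proof using B_lt.
move=> hq; rewrite /den.
have hB := B_lt; have B0 := sqr_ge0 B; have h1 : 0 < 1 + h by lra.
have cs : (B * q.1 - h * q.2) ^+ 2 < (1 + h) ^+ 2.
  have e : (B * q.1 - h * q.2) ^+ 2 + (B * q.2 + h * q.1) ^+ 2 =
    (B ^+ 2 + h ^+ 2) * (q.1 ^+ 2 + q.2 ^+ 2) by ring.
  have le : (B ^+ 2 + h ^+ 2) * (q.1 ^+ 2 + q.2 ^+ 2) <= B ^+ 2 + h ^+ 2.
    by rewrite ler_piMr// addr_ge0 ?sqr_ge0.
  have := sqr_ge0 (B * q.2 + h * q.1); rewrite sqrrD; lra.
have /ltr_normlP[] : `|B * q.1 - h * q.2| < 1 + h.
  by rewrite -(ger0_norm (ltW h1)) -ltr_sqr ?nnegrE ?normr_ge0// !real_normK ?num_real.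
lra.
Qed.

Lemma frx_chart q : frx (chart q) = q.1 * (p / den q).
Proof using tau_gt0. exact: frxK. Qed.

Lemma fry_chart q : fry (chart q) = (1 - q.2) * (p / den q).
Proof using tau_gt0. exact: fryK. Qed.

Lemma frw_chart q : den q != 0 -> frw (chart q) = p / den q.
Proof using tau_gt0.
by move=> hq; rewrite /frw frx_chart fry_chart; move: hq; rewrite /den => hq; field.
Qed.

Lemma frv_chart q : den q != 0 -> frv (chart q) = q.2 * (p / den q).
Proof using tau_gt0.
by move=> hq; rewrite /frv frw_chart// fry_chart; ring.
Qed.

Lemma frw_chart_gt0 q : q.1 ^+ 2 + q.2 ^+ 2 <= 1 -> 0 < frw (chart q).
Proof using B_lt p_gt0 tau_gt0.
by move=> /den_gt0 hq; rewrite frw_chart ?gt_eqF// divr_gt0.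
Qed.

Lemma chartK q : den q != 0 -> prj (chart q) = q.
Proof using p_gt0 tau_gt0.
move=> hq; have hp := lt0r_neq0 p_gt0.
rewrite /prj frw_chart// frv_chart// frx_chart.
case: q hq => q1 q2 hq /=.
by congr pair; rewrite mulfK// mulf_neq0// invr_neq0.
Qed.

Lemma den_prj P : frw P != 0 -> den (prj P) = p / frw P.
Proof using. by move=> hW; rewrite /den /prj /= /frv; rewrite /frw in hW *; field. Qed.

Lemma prjK P : frw P != 0 -> chart (prj P) = P.
Proof using p_gt0 tau_gt0.
move=> hW; have hp := lt0r_neq0 p_gt0.
apply: frpt_inj; rewrite ?frx_chart ?fry_chart den_prj// /prj /=.
  by field; rewrite ?hp ?hW.
by rewrite /frv; field; rewrite ?hp ?hW.
Qed.

(** If [y = 0], the equation forces [x = 0] and [w = p]. Otherwise [2 p y] is the value of a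
    positive definite form, so [y > 0], and [2 y w = x^2 + y^2] is positive. *)
Lemma frE_w_gt0 P : frE P -> 0 < frw P.
Proof using p_gt0 B_lt.
have hB := B_lt; have hp := p_gt0; rewrite /frE /= /frv; set x := frx P; set y := fry P.
have -> : frw P = p - B * x - h * y by [].
have [->|y0] := eqVneq y 0; first by nra.
move=> hE.
have hE' : (x + B * y) ^+ 2 + (1 + 2 * h - B ^+ 2) * y ^+ 2 = p * y *+ 2 by nra.
have y2 : 0 < y ^+ 2 by rewrite exprn_even_gt0.
have yp : 0 < y.
  suff : 0 < p * y by rewrite pmulr_rgt0.
  have := sqr_ge0 (x + B * y); nra.
suff : 0 < y * (p - B * x - h * y) by rewrite pmulr_rgt0.
have := sqr_ge0 x; nra.
Qed.

Lemma frE_chart q : q.1 ^+ 2 + q.2 ^+ 2 = 1 -> frE (chart q).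
Proof using B_lt p_gt0 tau_gt0.
move=> hq; have /den_gt0/lt0r_neq0 hd : q.1 ^+ 2 + q.2 ^+ 2 <= 1 by rewrite hq.
rewrite /frE /= frx_chart frv_chart// frw_chart//.
by rewrite !exprMn -mulrDl hq mul1r.
Qed.

Lemma frE_prj P : frE P -> (prj P).1 ^+ 2 + (prj P).2 ^+ 2 = 1.
Proof using B_lt p_gt0.
move=> hE; have W0 := lt0r_neq0 (frE_w_gt0 hE).
by move: hE; rewrite /frE /= !expr_div_n -mulrDl => ->; rewrite divff// expf_neq0.
Qed.

Lemma chart_org : chart (0, 1) = M.
Proof using. by rewrite /chart /frpt /= subrr !mul0r subr0 !addr0 -surjective_pairing. Qed.

Lemma chart_inj q q' : den q != 0 -> den q' != 0 -> chart q = chart q' -> q = q'.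
Proof using p_gt0 tau_gt0.
by move=> h1 h2 e; rewrite -(chartK h1) e chartK.
Qed.

Lemma dot_frame P Q : dot (P - M) (Q - M) =
  dot tau tau * (frx P * frx Q + fry P * fry Q).
Proof using tau_gt0.
have h0 := lt0r_neq0 tau_gt0; rewrite -{1}(frptK P) -{1}(frptK Q).
by rewrite /frpt /dot /=; ring.
Qed.

(** * Chords seen from M under a given angle *)

Lemma unitv_den v : unitv v -> 0 < den v.
Proof using B_lt. by move=> uv; apply: den_gt0; rewrite uv. Qed.

Lemma chart_neq_org v : unitv v -> v != (0, 1) -> chart v != M.
Proof using B_lt p_gt0 tau_gt0.
move=> uv; apply: contra_neq; rewrite -{1}chart_org.
have u1 : unitv ((0, 1) : R * R) by rewrite /unitv /= expr0n expr1n add0r.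
by apply: chart_inj; rewrite gt_eqF ?unitv_den.
Qed.

(** Seen from [M], the chart multiplies the vector [(v.1, 1 - v.2)] by a positive factor, which
    cancels in the cosine. On the unit circle its squared length is [2 (1 - v.2)]. *)
Lemma angle_chart v v' : unitv v -> unitv v' -> v.2 < 1 -> v'.2 < 1 ->
  angle (chart v) M (chart v') =
  acos ((v.1 * v'.1 + (1 - v.2) * (1 - v'.2))
        / (2 * Num.sqrt ((1 - v.2) * (1 - v'.2)))).
Proof using B_lt p_gt0 tau_gt0.
move=> uv uv' lv lv'; rewrite /angle; congr acos.
have D0 := tau_gt0.
have w0 : 0 < p / den v by rewrite divr_gt0 ?unitv_den.
have w0' : 0 < p / den v' by rewrite divr_gt0 ?unitv_den.
rewrite /enorm -sqrtrM; last by rewrite /dot addr_ge0 -?expr2 ?sqr_ge0.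
rewrite !dot_frame !frx_chart !fry_chart.
move: w0 w0'; set w := p / den v; set w' := p / den v' => w0 w0'.
set y := 1 - v.2; set y' := 1 - v'.2.
have hy : v.1 ^+ 2 + y ^+ 2 = 2 * y by move: uv; rewrite /unitv /y; lra.
have hy' : v'.1 ^+ 2 + y' ^+ 2 = 2 * y' by move: uv'; rewrite /unitv /y'; lra.
have yp : 0 < y * y' by rewrite mulr_gt0// subr_gt0.
rewrite [X in Num.sqrt X](_ : _ =
   (dot tau tau * w * w') ^+ 2 * ((v.1 ^+ 2 + y ^+ 2) * (v'.1 ^+ 2 + y' ^+ 2)));
  last by ring.
rewrite hy hy' [X in Num.sqrt X](_ : _ =
  (dot tau tau * w * w' * 2) ^+ 2 * (y * y')); last by ring.
have k0 : 0 <= dot tau tau * w * w' * 2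
  by apply/ltW/mulr_gt0 => //; apply: mulr_gt0 w0'; apply: mulr_gt0 w0.
rewrite sqrtrM ?sqr_ge0// sqrtr_sqr (ger0_norm k0).
have s0 : Num.sqrt (y * y') != 0 by rewrite gt_eqF// sqrtr_gt0.
by field; rewrite s0 !gt_eqF.
Qed.

(** The inscribed angle theorem read in the chart. The two signs of [t] are the two orders of the
    ends; [e.2 < cos theta] puts [(0, 1)], the image of [M], on the side where the chord is seen
    under [theta] and not [pi - theta]. *)
Lemma chordsP theta cc : 0 < theta < pi ->
  chords frE M theta cc <->
  exists e t, [/\ unitv e, e.2 < cos theta, t = sin theta \/ t = - sin theta &
    cc = (chart (endp (cos theta) t e), chart (endp (cos theta) (- t) e))].
Proof using B_lt p_gt0 tau_gt0.
move=> /andP[t0 tpi]; set c := cos theta; set s := sin theta.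
have cs : c ^+ 2 + s ^+ 2 = 1 by rewrite cos2Dsin2.
split.
  case: cc => N L [/= EN EL NM LM ang].
  have uv : unitv (prj N) := frE_prj EN.
  have uv' : unitv (prj L) := frE_prj EL.
  have KN : chart (prj N) = N by rewrite prjK// gt_eqF// frE_w_gt0.
  have KL : chart (prj L) = L by rewrite prjK// gt_eqF// frE_w_gt0.
  have lv : (prj N).2 < 1.
    by apply: unitv_snd_lt1 => //; apply: contra_neq NM => e; rewrite -KN e chart_org.
  have lv' : (prj L).2 < 1.
    by apply: unitv_snd_lt1 => //; apply: contra_neq LM => e; rewrite -KL e chart_org.
  move: ang; rewrite -{1}KN -{1}KL angle_chart//.
  move: KN KL uv uv' lv lv'; set v := prj N; set v' := prj L => KN KL uv uv' lv lv'.
  have yy0 : 0 < (1 - v.2) * (1 - v'.2) by rewrite mulr_gt0 ?subr_gt0.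
  set r := Num.sqrt _; set X := _ + _ => ang.
  have r0 : 0 < r by rewrite sqrtr_gt0.
  have r2 : r ^+ 2 = (1 - v.2) * (1 - v'.2) by rewrite sqr_sqrtr// ltW.
  have hc : X / (2 * r) = c.
    rewrite /c -ang acosK//.
    (* Inverting [acos] requires an argument in [[-1, 1]]; the bound comes from Lagrange's
       identity. *)
    have X2 : X ^+ 2 <= (2 * r) ^+ 2.
      have -> : (2 * r) ^+ 2 = X ^+ 2 + (v.1 * (1 - v'.2) - v'.1 * (1 - v.2)) ^+ 2.
        rewrite exprMn r2.
        have hy : v.1 ^+ 2 + (1 - v.2) ^+ 2 = 2 * (1 - v.2) by move: uv; rewrite /unitv; lra.
        have hy' : v'.1 ^+ 2 + (1 - v'.2) ^+ 2 = 2 * (1 - v'.2) by move: uv'; rewrite /unitv; lra.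
        transitivity ((v.1 ^+ 2 + (1 - v.2) ^+ 2) * (v'.1 ^+ 2 + (1 - v'.2) ^+ 2)).
          by rewrite hy hy'; ring.
        by rewrite /X; ring.
      by rewrite lerDl sqr_ge0.
    have r20 : 0 < 2 * r by rewrite mulr_gt0.
    have /ler_normlP[h1 h2] : `|X| <= 2 * r.
      by rewrite -(ger0_norm (ltW r20)) -ler_sqr ?nnegrE ?normr_ge0// !real_normK ?num_real.
    by rewrite in_itv /= ler_pdivlMr// ler_pdivrMr// mulN1r mul1r h2 lerNl h1.
  have hX : X = 2 * c * r by rewrite -hc; field; rewrite gt_eqF.
  have [e [t [ue lt et ev ev']]] := inscribed_endp cs uv uv' r0 r2 hX.
  by exists e, t; split; rewrite // -ev -ev' KN KL.
move=> [e [t [ue lt et ->]]].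
have cst : c ^+ 2 + t ^+ 2 = 1 by case: et => ->; rewrite ?sqrrN.
have cst' : c ^+ 2 + (- t) ^+ 2 = 1 by rewrite sqrrN.
have uv := unitv_endp cst ue; have uv' := unitv_endp cst' ue.
have lv := endp_snd_lt1 cst ue lt; have lv' := endp_snd_lt1 cst' ue lt.
have ne v : v.2 < 1 -> v != (0, 1) :> R * R.
  by move=> l; apply/eqP => E; rewrite E /= ltxx in l.
split => /=; [exact: frE_chart | exact: frE_chart | | |].
- by apply: chart_neq_org => //; exact: ne.
- by apply: chart_neq_org => //; exact: ne.
rewrite angle_chart// -[RHS]cosK ?in_itv /= ?ltW//; congr acos; rewrite -/c.
(* The product is a perfect square, so the root disappears and the cosine becomes [(c^2 - e.2^2 + (c
   - e.2)^2) / (2 (c - e.2)) = c]. *)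
have -> : (1 - (endp c t e).2) * (1 - (endp c (- t) e).2) = (c - e.2) ^+ 2.
  rewrite /=; have ue1 : e.1 ^+ 2 = 1 - e.2 ^+ 2 by rewrite -ue; ring.
  transitivity ((1 - c * e.2) ^+ 2 - t ^+ 2 * e.1 ^+ 2); first by ring.
  by rewrite ue1 (_ : t ^+ 2 = 1 - c ^+ 2); [ring | rewrite -cst; ring].
have ce : 0 < c - e.2 by rewrite subr_gt0.
rewrite sqrtr_sqr ger0_norm ?ltW//.
have -> : (endp c t e).1 * (endp c (- t) e).1 = c ^+ 2 - e.2 ^+ 2.
  rewrite /=; have ue1 : e.1 ^+ 2 = 1 - e.2 ^+ 2 by rewrite -ue; ring.
  transitivity (c ^+ 2 * e.1 ^+ 2 - t ^+ 2 * e.2 ^+ 2); first by ring.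
  by rewrite ue1 (_ : t ^+ 2 = 1 - c ^+ 2); [ring | rewrite -cst; ring].
by field; rewrite gt_eqF.
Qed.

(** * Segments and continuity in the chart *)

Lemma segment_line (e N L Q : R * R) (c : R) :
  frx N * e.1 + frv N * e.2 = c * frw N ->
  frx L * e.1 + frv L * e.2 = c * frw L ->
  segment (N, L) Q -> frx Q * e.1 + frv Q * e.2 = c * frw Q.
Proof using.
move=> eN eL [k k01 ->].
have Ex : frx ((1 - k) *: N + k *: L) = (1 - k) * frx N + k * frx L.
  by rewrite /frx /dot /= /GRing.scale /=; ring.
have Ey : fry ((1 - k) *: N + k *: L) = (1 - k) * fry N + k * fry L.
  by rewrite /fry /dot /= /GRing.scale /=; ring.
have Ew : frw ((1 - k) *: N + k *: L) = (1 - k) * frw N + k * frw L.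
  by rewrite /frw Ex Ey; ring.
have Ev : frv ((1 - k) *: N + k *: L) = (1 - k) * frv N + k * frv L.
  by rewrite /frv Ew Ey; ring.
rewrite Ex Ev Ew.
transitivity ((1 - k) * (frx N * e.1 + frv N * e.2)
              + k * (frx L * e.1 + frv L * e.2)); first by ring.
by rewrite eN eL; ring.
Qed.

(** A projective map keeps segments on which its denominator is positive; barycentric weights are
    multiplied by the denominators at the ends, whence the parameter [k * den v' / den q0]. *)
Lemma chart_segment (v v' q : R * R) (k : R) : 0 < den v -> 0 < den v' ->
  0 <= k <= 1 -> q = ((1 - k) * v.1 + k * v'.1, (1 - k) * v.2 + k * v'.2) ->
  segment (chart v, chart v') (chart q).
Proof using.
move=> d0 d0' /andP[k0 k1] ->.
set q0 := (_ + _, _ + _).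
have dq : den q0 = (1 - k) * den v + k * den v' by rewrite /den /=; ring.
have k1' : 0 <= 1 - k by rewrite subr_ge0.
have dq0 : 0 < den q0.
  rewrite dq; have [->|kn] := eqVneq k 0; first by rewrite subr0 mul1r mul0r addr0.
  by rewrite ltr_wpDl ?mulr_ge0 ?(ltW d0)// mulr_gt0// lt_def kn.
exists (k * den v' / den q0).
  rewrite divr_ge0 ?(ltW dq0) ?mulr_ge0 ?(ltW d0')//= ler_pdivrMr// mul1r dq.
  by rewrite lerDr mulr_ge0// ltW.
have n0 := lt0r_neq0 dq0; have n1 := lt0r_neq0 d0; have n2 := lt0r_neq0 d0'.
have -> : 1 - k * den v' / den q0 = (1 - k) * den v / den q0.
  by rewrite -[X in X - _](divff n0) -mulrBl; congr (_ / _); rewrite dq; ring.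
rewrite /chart /frpt /= dq; rewrite dq in n0.
by apply: injective_projections; rewrite /= /GRing.scale /=; field; rewrite n0 n1 n2.
Qed.

Lemma endp_line (c t : R) (e : R * R) : c ^+ 2 + t ^+ 2 = 1 -> unitv e ->
  let P := chart (endp c t e) in frx P * e.1 + frv P * e.2 = c * frw P.
Proof using B_lt p_gt0 tau_gt0.
move=> ct ue /=; have d0 := lt0r_neq0 (unitv_den (unitv_endp ct ue)).
rewrite frx_chart frv_chart// frw_chart// !mulrA -(mulrC e.1) -(mulrC e.2) /=.
transitivity (c * (e.1 ^+ 2 + e.2 ^+ 2) * (p / den (endp c t e))); first by ring.
by rewrite ue; ring.
Qed.

Lemma chord_line (c t : R) (e Q : R * R) : c ^+ 2 + t ^+ 2 = 1 -> unitv e ->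
  segment (chart (endp c t e), chart (endp c (- t) e)) Q ->
  frx Q * e.1 + frv Q * e.2 = c * frw Q.
Proof using B_lt p_gt0 tau_gt0.
move=> ct ue; apply: segment_line; apply: endp_line => //.
by rewrite sqrrN.
Qed.

Lemma chart_in_chord (c t : R) (e q : R * R) : c ^+ 2 + t ^+ 2 = 1 -> t != 0 ->
  unitv e -> q.1 * e.1 + q.2 * e.2 = c -> q.1 ^+ 2 + q.2 ^+ 2 <= 1 ->
  segment (chart (endp c t e), chart (endp c (- t) e)) (chart q).
Proof using B_lt.
move=> ct t0 ue qe q1.
have ct' : c ^+ 2 + (- t) ^+ 2 = 1 by rewrite sqrrN.
(* The coordinate of [q] along the chord: it equals [t] at the first end and [- t] at the second,
   and the disc condition bounds it between them. *)
set b := q.2 * e.1 - q.1 * e.2.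
have hb : b ^+ 2 <= t ^+ 2.
  have : c ^+ 2 + b ^+ 2 = q.1 ^+ 2 + q.2 ^+ 2.
    rewrite -qe -[RHS]mulr1 -ue /b; ring.
  lra.
have /ler_normlP[b1 b2] : `|b / t| <= 1.
  rewrite -(@expr_le1 _ 2)// ?normr_ge0// real_normK ?num_real//.
  by rewrite expr_div_n ler_pdivrMr ?mul1r// exprn_even_gt0.
apply: (@chart_segment _ _ _ ((1 - b / t) / 2)).
- exact/unitv_den/unitv_endp.
- exact/unitv_den/unitv_endp.
- by apply/andP; split; lra.
apply: injective_projections => /=.
  transitivity ((q.1 * e.1 + q.2 * e.2) * e.1 - b * e.2).
    by rewrite -[LHS]mulr1 -ue /b; ring.
  by rewrite qe; field.
transitivity ((q.1 * e.1 + q.2 * e.2) * e.2 + b * e.1).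
  by rewrite -[LHS]mulr1 -ue /b; ring.
by rewrite qe; field.
Qed.

Section Continuity.
Context {T : Type} {F : set_system T} {FF : Filter F}.
Implicit Types (f : T -> R * R) (P q : R * R).

Lemma cvg_prod1 f P : f @ F --> P -> (fun x => (f x).1) @ F --> P.1.
Proof using FF. by move=> fP; exact: (cvg_comp f fst fP cvg_fst). Qed.

Lemma cvg_prod2 f P : f @ F --> P -> (fun x => (f x).2) @ F --> P.2.
Proof using FF. by move=> fP; exact: (cvg_comp f snd fP cvg_snd). Qed.

Lemma cvg_frx f P : f @ F --> P -> (fun x => frx (f x)) @ F --> frx P.
Proof using FF.
move=> fP; rewrite /frx /dot /=; apply: cvgM; last exact: cvg_cst.
apply: cvgD; apply: cvgM; try exact: cvg_cst.
  by apply: cvgB; [exact: cvg_prod1|exact: cvg_cst].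
by apply: cvgB; [exact: cvg_prod2|exact: cvg_cst].
Qed.

Lemma cvg_fry f P : f @ F --> P -> (fun x => fry (f x)) @ F --> fry P.
Proof using FF.
move=> fP; rewrite /fry /dot /=; apply: cvgM; last exact: cvg_cst.
apply: cvgD; apply: cvgM; try exact: cvg_cst.
  by apply: cvgB; [exact: cvg_prod1|exact: cvg_cst].
by apply: cvgB; [exact: cvg_prod2|exact: cvg_cst].
Qed.

Lemma cvg_frw f P : f @ F --> P -> (fun x => frw (f x)) @ F --> frw P.
Proof using FF.
move=> fP; rewrite /frw; apply: cvgB.
  apply: cvgB; [exact: cvg_cst | apply: cvgM; [exact: cvg_cst|exact: cvg_frx]].
by apply: cvgM; [exact: cvg_cst|exact: cvg_fry].
Qed.

Lemma cvg_frv f P : f @ F --> P -> (fun x => frv (f x)) @ F --> frv P.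
Proof using FF.
by move=> fP; rewrite /frv; apply: cvgB; [exact: cvg_frw|exact: cvg_fry].
Qed.

Lemma cvg_prj f P : frw P != 0 -> f @ F --> P -> (fun x => prj (f x)) @ F --> prj P.
Proof using FF.
move=> w0 fP; apply: (cvg_pair (G := nbhs (prj P).1) (H := nbhs (prj P).2)).
  by apply: cvgM; [exact: cvg_frx|apply: cvgV => //; exact: cvg_frw].
by apply: cvgM; [exact: cvg_frv|apply: cvgV => //; exact: cvg_frw].
Qed.

Lemma cvg_chart f q : den q != 0 -> f @ F --> q -> (fun x => chart (f x)) @ F --> chart q.
Proof using FF.
move=> d0 fq; have f1 := cvg_prod1 fq; have f2 := cvg_prod2 fq.
have fw : (fun x => p / den (f x)) @ F --> p / den q.
  apply: cvgM; first exact: cvg_cst.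
  apply: cvgV => //; apply: cvgB.
    apply: cvgD; first exact: cvg_cst.
    by apply: cvgM => //; exact: cvg_cst.
  by apply: cvgM => //; exact: cvg_cst.
have fx : (fun x => (f x).1 * (p / den (f x))) @ F --> q.1 * (p / den q) by exact: cvgM.
have fy : (fun x => (1 - (f x).2) * (p / den (f x))) @ F --> (1 - q.2) * (p / den q).
  by apply: cvgM => //; apply: cvgB => //; exact: cvg_cst.
apply: (cvg_pair (G := nbhs (chart q).1) (H := nbhs (chart q).2)).
  apply: cvgB; last by apply: cvgM => //; exact: cvg_cst.
  by apply: cvgD; [exact: cvg_cst|apply: cvgM => //; exact: cvg_cst].
apply: cvgD; last by apply: cvgM => //; exact: cvg_cst.
by apply: cvgD; [exact: cvg_cst|apply: cvgM => //; exact: cvg_cst].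
Qed.

End Continuity.

(** * The envelope of the chords *)

Definition chord (c t : R) (e : R * R) : (R * R) * (R * R) :=
  (chart (endp c t e), chart (endp c (- t) e)).

Lemma cvg_endp {T : Type} {F : set_system T} {FF : Filter F} (c t : R)
    (f : T -> R * R) e :
  f @ F --> e -> (fun x => endp c t (f x)) @ F --> endp c t e.
Proof using.
move=> fe; have f1 := cvg_prod1 (FF := FF) fe; have f2 := cvg_prod2 (FF := FF) fe.
apply: (cvg_pair (G := nbhs (c * e.1 - t * e.2))
  (H := nbhs (c * e.2 + t * e.1))).
  by apply: cvgB; apply: cvgM => //; exact: cvg_cst.
by apply: cvgD; apply: cvgM => //; exact: cvg_cst.
Qed.

Lemma cvg_chord {T : Type} {F : set_system T} {FF : Filter F} (c t : R)
    (f : T -> R * R) e : c ^+ 2 + t ^+ 2 = 1 -> unitv e ->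
  f @ F --> e -> (fun x => chord c t (f x)) @ F --> chord c t e.
Proof using B_lt p_gt0 tau_gt0.
move=> ct ue fe; have ct' : c ^+ 2 + (- t) ^+ 2 = 1 by rewrite sqrrN.
apply: (cvg_pair (G := nbhs (chord c t e).1) (H := nbhs (chord c t e).2)).
  apply: cvg_chart; last exact: cvg_endp.
  exact/lt0r_neq0/unitv_den/unitv_endp.
apply: cvg_chart; last exact: cvg_endp.
exact/lt0r_neq0/unitv_den/unitv_endp.
Qed.

(** Here [endp (cos k) (sin k)] serves as the rotation by [k]; turning the normal by small [k > 0]
    produces the neighbouring chords. *)
Lemma cvg_rot (e : R * R) :
  endp (cos k) (sin k) e @[k --> (0 : R)^'+] --> e.
Proof using.
have c1 : cos k @[k --> (0 : R)^'+] --> (1 : R).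
  by rewrite -(@cos0 R); apply: cvg_at_right_filter; exact: continuous_cos.
have s0 : sin k @[k --> (0 : R)^'+] --> (0 : R).
  by rewrite -[X in _ --> X](@sin0 R); apply: cvg_at_right_filter; exact: continuous_sin.
have -> : nbhs e = nbhs ((1 * e.1 - 0 * e.2, 1 * e.2 + 0 * e.1) : R * R).
  by rewrite !mul1r !mul0r subr0 addr0 -surjective_pairing.
apply: (cvg_pair (G := nbhs (1 * e.1 - 0 * e.2)) (H := nbhs (1 * e.2 + 0 * e.1))).
  by apply: cvgB; apply: cvgM => //; exact: cvg_cst.
by apply: cvgD; apply: cvgM => //; exact: cvg_cst.
Qed.

Lemma near_sin_gt0 : \forall k \near (0 : R)^'+, 0 < sin k.
Proof using.
near=> k; apply: sin_gt0_pi; apply/andP; split; first by near: k; exact: nbhs_right_gt.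
by near: k; apply: nbhs_right_lt; exact: pi_gt0.
Unshelve. all: by end_near. Qed.

Lemma near_rot_lt (e : R * R) (c : R) : e.2 < c ->
  \forall k \near (0 : R)^'+, (endp (cos k) (sin k) e).2 < c.
Proof using. by move=> lt; apply: cvgr_lt lt; exact: cvg_prod2 (@cvg_rot e). Qed.

Lemma unitv_rot k (e : R * R) : unitv e -> unitv (endp (cos k) (sin k) e).
Proof using. by apply: unitv_endp; rewrite cos2Dsin2. Qed.

Lemma endp_inj c t (e e' : R * R) : c ^+ 2 + t ^+ 2 = 1 ->
  endp c t e = endp c t e' -> e = e'.
Proof using.
move=> ct [h1 h2]; apply: injective_projections; rewrite -[LHS]mul1r -[RHS]mul1r -ct.
  transitivity (c * (c * e.1 - t * e.2) + t * (c * e.2 + t * e.1)); first by ring.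
  by rewrite h1 h2; ring.
transitivity (c * (c * e.2 + t * e.1) - t * (c * e.1 - t * e.2)); first by ring.
by rewrite h1 h2; ring.
Qed.

Lemma chord_inj c t e e' : c ^+ 2 + t ^+ 2 = 1 -> unitv e -> unitv e' ->
  chord c t e = chord c t e' -> e = e'.
Proof using B_lt p_gt0 tau_gt0.
move=> ct ue ue' E; apply: (endp_inj ct).
apply: (chart_inj _ _ (congr1 fst E)); exact/lt0r_neq0/unitv_den/unitv_endp.
Qed.

Lemma rot_neq k (e : R * R) : unitv e -> sin k != 0 -> endp (cos k) (sin k) e != e.
Proof using.
move=> ue; apply: contra_neq => /(congr1 (fun x => x.2 * e.1 - x.1 * e.2)) /= h0.
rewrite -[LHS]mulr1 -ue.
transitivity ((cos k * e.2 + sin k * e.1) * e.1 - (cos k * e.1 - sin k * e.2) * e.2); first by ring.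
by rewrite h0; ring.
Qed.

Lemma chords_chord theta t e : 0 < theta < pi -> unitv e -> e.2 < cos theta ->
  t = sin theta \/ t = - sin theta -> chords frE M theta (chord (cos theta) t e).
Proof using B_lt p_gt0 tau_gt0. by move=> th ue lt ht; apply/chordsP => //; exists e, t. Qed.

(** Approaching through [k > 0] keeps [sin k] nonzero, so the rotated chord is a different one. This
    gives both the accumulation of chords and the neighbours to which the envelope condition is
    applied. *)
Lemma near_chord theta t e : 0 < theta < pi -> unitv e -> e.2 < cos theta ->
  t = sin theta \/ t = - sin theta ->
  forall A, nbhs (chord (cos theta) t e) A ->
  \forall k \near (0 : R)^'+,
   [/\ 0 < sin k, A (chord (cos theta) t (endp (cos k) (sin k) e)),
      chords frE M theta (chord (cos theta) t (endp (cos k) (sin k) e)) &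
      chord (cos theta) t (endp (cos k) (sin k) e) != chord (cos theta) t e].
Proof using B_lt p_gt0 tau_gt0.
move=> th ue lt ht A nA.
have ct : cos theta ^+ 2 + t ^+ 2 = 1 by case: ht => ->; rewrite ?sqrrN cos2Dsin2.
have nl := near_rot_lt lt; have ns := near_sin_gt0.
have nAk : \forall k \near (0 : R)^'+, A (chord (cos theta) t (endp (cos k) (sin k) e)).
  exact: (cvg_chord ct ue (@cvg_rot e)).
near=> k.
have sk : 0 < sin k by near: k.
have uk := unitv_rot k ue.
split => //; first by near: k.
  by apply: chords_chord => //; near: k.
by apply: contra_neq (rot_neq ue (lt0r_neq0 sk)) => /(chord_inj ct uk ue).
Unshelve. all: by end_near. Qed.

Lemma chord_limit_point theta t e : 0 < theta < pi -> unitv e -> e.2 < cos theta ->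
  t = sin theta \/ t = - sin theta ->
  limit_point (chords frE M theta) (chord (cos theta) t e).
Proof using B_lt p_gt0 tau_gt0.
move=> th ue lt ht A nA; have [k [_ Ak Fk nk]] :=
  @filter_ex _ _ (at_right_proper_filter _) _ (near_chord th ue lt ht nA).
by exists (chord (cos theta) t (endp (cos k) (sin k) e)).
Qed.

(** Two lines at distance [|c|] from the origin whose normals form an angle [k] meet at distance
    [|c| / |cos (k / 2)|], and [2 cos^2 (k / 2) = 1 + cos k]. The homogeneous polynomial form passes
    to the limit [k = 0]. *)
Lemma secant_point (c k : R) (e Q : R * R) : unitv e -> sin k != 0 ->
  frx Q * e.1 + frv Q * e.2 = c * frw Q ->
  frx Q * (endp (cos k) (sin k) e).1 + frv Q * (endp (cos k) (sin k) e).2 = c * frw Q ->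
  (frx Q ^+ 2 + frv Q ^+ 2) * (1 + cos k) = 2 * c ^+ 2 * frw Q ^+ 2.
Proof using.
move=> ue sk /=; set U := frx Q; set V := frv Q; set W := c * frw Q => h1 h2.
set b := V * e.1 - U * e.2.
have UV : U ^+ 2 + V ^+ 2 = W ^+ 2 + b ^+ 2.
  by rewrite -h1 -[LHS]mulr1 -ue /b; ring.
have hb : sin k * b = W - cos k * W by rewrite -[X in X - _]h2 -h1 /b; ring.
have s2 : sin k ^+ 2 = (1 - cos k) * (1 + cos k) by rewrite -[LHS](addKr (cos k ^+ 2)) cos2Dsin2; ring.
have ck : 1 - cos k != 0.
  by apply: contra_neq sk => ck; apply/eqP; rewrite -sqrf_eq0 s2 ck mul0r.
have hb2 : b ^+ 2 * (1 + cos k) = W ^+ 2 * (1 - cos k).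
  apply: (mulfI ck); transitivity ((sin k * b) ^+ 2).
    by rewrite exprMn s2; ring.
  by rewrite hb; ring.
by rewrite UV mulrDl hb2 /W; ring.
Qed.

Lemma envelope_sub theta : 0 < theta < pi ->
  envelope (chords frE M theta) `<=`
  [set P | frx P ^+ 2 + frv P ^+ 2 = cos theta ^+ 2 * frw P ^+ 2].
Proof using B_lt p_gt0 tau_gt0.
move=> th P [cc [/chordsP-/(_ th)[e [t [ue lt ht ->]]] _ env]] /=.
rewrite -/(chord _ _ _) in env.
set c := cos theta in lt env *.
have ct : c ^+ 2 + t ^+ 2 = 1 by case: ht => ->; rewrite ?sqrrN cos2Dsin2.
pose H (z : (R * R) * R) : R :=
  (frx z.1 ^+ 2 + frv z.1 ^+ 2) * (1 + cos z.2) - 2 * c ^+ 2 * frw z.1 ^+ 2.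
have HP : H z @[z --> (P, 0 : R)] --> H (P, 0).
  have c1 : (fun z : (R * R) * R => z.1) @ (P, 0 : R) --> P by exact: cvg_fst.
  have c2 : (fun z : (R * R) * R => z.2) @ (P, 0 : R) --> (0 : R) by exact: cvg_snd.
  have cc2 : (fun z : (R * R) * R => cos z.2) @ (P, 0 : R) --> cos (0 : R).
    exact: (cvg_comp snd cos c2 (@continuous_cos R 0)).
  rewrite /H; apply: cvgB; apply: cvgM.
  - by apply: cvgD; [apply: cvgM; exact: cvg_frx|apply: cvgM; exact: cvg_frv].
  - by apply: cvgD => //; exact: cvg_cst.
  - exact: cvg_cst.
  - by apply: cvgM; exact: cvg_frw.
(* [H] vanishes at (Q, k) when Q is the intersection of the chords of normals
   [e] and [e] rotated by k <> 0, hence at the limit (P, 0). *)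
apply/eqP; apply: contraT => neq.
have H0 : H (P, 0) != 0.
  rewrite /H /= cos0 subr_eq0 -subr_eq0; apply: contra neq; rewrite subr_eq0 => /eqP e0.
  by apply/eqP; lra.
have [[A K] /= [nA nK] AK] := cvgr_neq0 _ HP H0.
have [k] : exists k, [/\ 0 < sin k, K k & exists Q, [/\ A Q, segment (chord c t e) Q &
    segment (chord c t (endp (cos k) (sin k) e)) Q]].
  apply: (@filter_ex _ ((0 : R)^'+)); have := near_chord th ue lt ht (env _ nA).
  have nKr : \forall k \near (0 : R)^'+, K k by exact: (cvg_within _ nK).
  apply: filterS2 nKr => k Kk [sk env' Fk nk].
  by split => //; apply: env'.
move=> [sk Kk [Q [AQ s1 s2]]].
have l1 := chord_line ct ue s1; have l2 := chord_line ct (unitv_rot k ue) s2.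
have := secant_point ue (lt0r_neq0 sk) l1 l2 => e0.
by have := AK (Q, k) (conj AQ Kk); rewrite /H /= e0 subrr eqxx.
Qed.

(** In the chart the midpoint of a chord is [c] times its normal. This recovers the normal
    continuously from the chord and does not depend on the order of the ends. *)
Definition chord_normal (c : R) (cc : (R * R) * (R * R)) : R * R :=
  (((prj cc.1).1 + (prj cc.2).1) / (2 * c), ((prj cc.1).2 + (prj cc.2).2) / (2 * c)).

Lemma chord_normalE c t e : c != 0 -> c ^+ 2 + t ^+ 2 = 1 -> unitv e ->
  chord_normal c (chord c t e) = e.
Proof using B_lt p_gt0 tau_gt0.
move=> c0 ct ue; have ct' : c ^+ 2 + (- t) ^+ 2 = 1 by rewrite sqrrN.
have d1 := lt0r_neq0 (unitv_den (unitv_endp ct ue)).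
have d2 := lt0r_neq0 (unitv_den (unitv_endp ct' ue)).
rewrite /chord_normal /chord /fst /snd -/(fst _) -/(snd _) !chartK//.
by apply: injective_projections => /=; field.
Qed.

Lemma cvg_chord_normal c t e : c != 0 -> c ^+ 2 + t ^+ 2 = 1 -> unitv e ->
  chord_normal c cc @[cc --> chord c t e] --> e.
Proof using B_lt p_gt0 tau_gt0.
move=> c0 ct ue; have ct' : c ^+ 2 + (- t) ^+ 2 = 1 by rewrite sqrrN.
have w1 : frw (chord c t e).1 != 0.
  by apply/lt0r_neq0/frw_chart_gt0; rewrite (unitv_endp ct ue).
have w2 : frw (chord c t e).2 != 0.
  by apply/lt0r_neq0/frw_chart_gt0; rewrite (unitv_endp ct' ue).
have c1 : prj cc.1 @[cc --> chord c t e] --> prj (chord c t e).1.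
  by apply: cvg_prj => //; exact: cvg_fst.
have c2 : prj cc.2 @[cc --> chord c t e] --> prj (chord c t e).2.
  by apply: cvg_prj => //; exact: cvg_snd.
rewrite -[X in _ --> X](chord_normalE c0 ct ue).
apply: (cvg_pair (G := nbhs (chord_normal c (chord c t e)).1)
   (H := nbhs (chord_normal c (chord c t e)).2)).
  by apply: cvgM; [apply: cvgD; exact: cvg_prod1|exact: cvg_cst].
by apply: cvgM; [apply: cvgD; exact: cvg_prod2|exact: cvg_cst].
Qed.

(* The affine chart coordinates of the intersection of the chords of normals
   [e] and [z]; for [z = e] it is the contact point of the chord. *)
Definition meet_pt (c : R) (e z : R * R) : R * R :=
  (c * (e.1 + z.1) / (1 + (e.1 * z.1 + e.2 * z.2)),
   c * (e.2 + z.2) / (1 + (e.1 * z.1 + e.2 * z.2))).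

Lemma meet_pt_line c e z : unitv e -> 1 + (e.1 * z.1 + e.2 * z.2) != 0 ->
  (meet_pt c e z).1 * e.1 + (meet_pt c e z).2 * e.2 = c.
Proof using.
move=> ue n0; rewrite /=.
transitivity (c * ((e.1 ^+ 2 + e.2 ^+ 2) + (e.1 * z.1 + e.2 * z.2))
  / (1 + (e.1 * z.1 + e.2 * z.2))); first by field.
by rewrite ue mulfK.
Qed.

Lemma meet_ptC c e z : meet_pt c e z = meet_pt c z e.
Proof using. by rewrite /meet_pt; congr pair; congr (_ / _); ring. Qed.

(** As [|e + z|^2 = 2 (1 + e . z)], the squared norm is [2 c^2 / (1 + e . z)]. *)
Lemma meet_pt_norm c e z : unitv e -> unitv z ->
  0 < 1 + (e.1 * z.1 + e.2 * z.2) -> 2 * c ^+ 2 <= 1 + (e.1 * z.1 + e.2 * z.2) ->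
  (meet_pt c e z).1 ^+ 2 + (meet_pt c e z).2 ^+ 2 <= 1.
Proof using.
move=> ue uz d0 le.
suff -> : (meet_pt c e z).1 ^+ 2 + (meet_pt c e z).2 ^+ 2
    = 2 * c ^+ 2 / (1 + (e.1 * z.1 + e.2 * z.2)) by rewrite ler_pdivrMr// mul1r.
have n0 := lt0r_neq0 d0.
rewrite /= !expr_div_n -mulrDl; apply: (canLR (mulfK _)); first by rewrite expf_neq0.
transitivity (c ^+ 2 * ((e.1 ^+ 2 + e.2 ^+ 2) + (z.1 ^+ 2 + z.2 ^+ 2)
                        + 2 * (e.1 * z.1 + e.2 * z.2))); first by ring.
by rewrite ue uz; field.
Qed.

Lemma cvg_meet_pt c e : unitv e ->
  meet_pt c e z @[z --> e] --> ((c * e.1, c * e.2) : R * R).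
Proof using.
move=> ue.
have E : 1 + (e.1 * e.1 + e.2 * e.2) = 2 by rewrite -!expr2 ue.
have n0 : 1 + (e.1 * e.1 + e.2 * e.2) != 0 by rewrite E pnatr_eq0.
have -> : nbhs ((c * e.1, c * e.2) : R * R) = nbhs (meet_pt c e e).
  by congr nbhs; rewrite /meet_pt E; congr pair; field.
have c1 : z.1 @[z --> e] --> e.1 by exact: cvg_prod1.
have c2 : z.2 @[z --> e] --> e.2 by exact: cvg_prod2.
have cd : (1 + (e.1 * z.1 + e.2 * z.2))^-1 @[z --> e] -->
   (1 + (e.1 * e.1 + e.2 * e.2))^-1.
  apply: cvgV => //; apply: cvgD; first exact: cvg_cst.
  by apply: cvgD; apply: cvgM => //; exact: cvg_cst.
apply: (cvg_pair (G := nbhs (meet_pt c e e).1) (H := nbhs (meet_pt c e e).2)).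
  apply: cvgM => //; apply: cvgM; first exact: cvg_cst.
  by apply: cvgD => //; exact: cvg_cst.
apply: cvgM => //; apply: cvgM; first exact: cvg_cst.
by apply: cvgD => //; exact: cvg_cst.
Qed.

(** The point is the contact point of the chord of normal [e]. A nearby chord has a normal [z] close
    to [e]; their intersection [meet_pt c e z] is close to [c e], hence inside the disc and on both
    segments. *)
Lemma chart_envelope theta e : 0 < theta < pi -> cos theta != 0 ->
  unitv e -> e.2 < cos theta ->
  envelope (chords frE M theta) (chart (cos theta * e.1, cos theta * e.2)).
Proof using B_lt p_gt0 tau_gt0.
move=> th c0 ue lt; have [t0 tpi] := andP th.
have s0 : 0 < sin theta by apply: sin_gt0_pi.
exists (chord (cos theta) (sin theta) e); split.
- by apply: chords_chord => //; left.
- by apply: chord_limit_point => //; left.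
set c := cos theta in c0 lt *; set s := sin theta in s0 *.
have cs : c ^+ 2 + s ^+ 2 = 1 by rewrite cos2Dsin2.
have c2lt : c ^+ 2 < 1.
  by rewrite -cs ltrDl exprn_gt0.
have nq : ((c * e.1, c * e.2) : R * R).1 ^+ 2 + ((c * e.1, c * e.2) : R * R).2 ^+ 2 <= 1.
  by rewrite /= !exprMn -mulrDr ue mulr1 ltW.
move=> U nU.
have cN := cvg_chord_normal c0 cs ue.
have cM := cvg_comp _ _ cN (cvg_meet_pt (c := c) ue).
have nU' : \forall cc \near chord c s e, U (chart (meet_pt c e (chord_normal c cc))).
  exact: (cvg_chart (lt0r_neq0 (den_gt0 nq)) cM).
(* At [z = e] the inequality reads [2 c^2 < 2], so it persists nearby. *)
have nD : \forall cc \near chord c s e, 2 * c ^+ 2 <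
    1 + (e.1 * (chord_normal c cc).1 + e.2 * (chord_normal c cc).2).
  have cD : (1 + (e.1 * (chord_normal c cc).1 + e.2 * (chord_normal c cc).2))
      @[cc --> chord c s e] --> 1 + (e.1 * e.1 + e.2 * e.2).
    apply: cvgD; first exact: cvg_cst.
    apply: cvgD; apply: cvgM; try exact: cvg_cst.
      exact: cvg_prod1.
    exact: cvg_prod2.
  by apply: cvgr_gt cD _ _; rewrite -!expr2 ue; lra.
near=> cc => /chordsP-/(_ th)[z [t [uz _ ht Ecc]]] _.
rewrite -/c -/s in ht Ecc.
have ct : c ^+ 2 + t ^+ 2 = 1 by case: ht => ->; rewrite ?sqrrN.
have Nz : chord_normal c cc = z by rewrite Ecc; exact: chord_normalE.
exists (chart (meet_pt c e z)).
have D : 2 * c ^+ 2 < 1 + (e.1 * z.1 + e.2 * z.2) by rewrite -Nz; near: cc.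
have D0 : 0 < 1 + (e.1 * z.1 + e.2 * z.2).
  by apply: le_lt_trans D; rewrite mulr_ge0// sqr_ge0.
have D0' : 1 + (z.1 * e.1 + z.2 * e.2) != 0.
  by rewrite mulrC (mulrC z.2) lt0r_neq0.
have nm := meet_pt_norm ue uz D0 (ltW D).
have tn : t != 0 by case: ht => ->; rewrite ?oppr_eq0 lt0r_neq0.
split.
- by rewrite -Nz; near: cc.
- by apply: chart_in_chord => //; rewrite ?lt0r_neq0// meet_pt_line// lt0r_neq0.
- by rewrite Ecc; apply: chart_in_chord => //; rewrite meet_ptC meet_pt_line.
Unshelve. all: by end_near. Qed.

(** * The centre of the Fregier ellipse *)

Definition conic (c : R) (P : R * R) : R :=
  frx P ^+ 2 + frv P ^+ 2 - c ^+ 2 * frw P ^+ 2.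

(** The functions [frx], [frv], [frw] act as homogeneous coordinates: since 1 is a combination of
    them, affine functions become linear forms and quadratic equations quadratic forms. *)
Lemma affine_unit P :
  1 = B / p * frx P + - (h / p) * frv P + (1 + h) / p * frw P.
Proof using p_gt0.
by have p0 := lt0r_neq0 p_gt0; rewrite /frv /frw; field.
Qed.

Lemma affine_form (v K : R * R) (d : R) : exists a b g, forall P,
  dot (P - K) v / d = a * frx P + b * frv P + g * frw P.
Proof using tau_gt0 p_gt0.
have p0 := lt0r_neq0 p_gt0.
pose k := dot (M - K) v.
exists ((dot tau v + k * B / p) / d), ((- dot (rot90 tau) v - k * h / p) / d),
  ((dot (rot90 tau) v + k * (1 + h) / p) / d) => P.
have -> : dot (P - K) v = k + frx P * dot tau v + fry P * dot (rot90 tau) v.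
  by rewrite -{1}(frptK P) /k /dot /frpt /=; ring.
have -> : fry P = frw P - frv P by rewrite /frv; ring.
transitivity ((k * (B / p * frx P + - (h / p) * frv P + (1 + h) / p * frw P)
  + frx P * dot tau v + (frw P - frv P) * dot (rot90 tau) v) / d).
  by rewrite -affine_unit mulr1.
by ring.
Qed.

(** The equation of [S], as a quadratic form in [frx], [frv], [frw], vanishes on the arc, so by
    [quad_form_arc] it is a multiple of [conic c]. The factor is nonzero because the left side is -1
    at [K], and that side is symmetric about [K]. *)
Lemma ellipse_conic_sym (c : R) (K : R * R) (S : set (R * R)) :
  c != 0 -> -1 < c < 1 -> ellipse_at K S ->
  (forall e, unitv e -> e.2 < c -> S (chart (c * e.1, c * e.2))) ->
  forall P, conic c (K + K - P) = conic c P.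
Proof using B_lt p_gt0 tau_gt0.
move=> c0 /andP[c1 c1'] [u [a [b [_ _ _ ->]]]] /= H.
have [a1 [b1 [g1 E1]]] := affine_form u K a.
have [a2 [b2 [g2 E2]]] := affine_form (rot90 u) K b.
have := affine_unit.
move: (B / p) (- (h / p)) ((1 + h) / p) => a3 b3 g3 E3.
have [|A2 A4 A5 A3 A6] := quad_form_arc
  (A1 := a1 ^+ 2 + a2 ^+ 2 - a3 ^+ 2)
  (A2 := 2 * (a1 * b1 + a2 * b2 - a3 * b3))
  (A3 := b1 ^+ 2 + b2 ^+ 2 - b3 ^+ 2)
  (A4 := 2 * (a1 * g1 + a2 * g2 - a3 * g3))
  (A5 := 2 * (b1 * g1 + b2 * g2 - b3 * g3))
  (A6 := g1 ^+ 2 + g2 ^+ 2 - g3 ^+ 2) c0 c1.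
  move=> e ue lt; have := H e ue lt; rewrite E1 E2.
  set q := (c * e.1, c * e.2).
  have d0 : 0 < den q.
    apply: den_gt0; rewrite /= !exprMn -mulrDr ue mulr1.
    by rewrite -(expr1n _ 2) -subr_ge0 subr_sqr mulr_ge0 ?subr_ge0 ?ltW// -ltrBlDl sub0r.
  pose w := p / den q; have w0 : w != 0 by rewrite mulf_neq0 ?invr_neq0 ?lt0r_neq0.
  have := E3 (chart q).
  rewrite frx_chart frv_chart ?lt0r_neq0// frw_chart ?lt0r_neq0//.
  rewrite -/w => one /eqP; rewrite -subr_eq0 => /eqP E.
  apply: (mulIf (expf_neq0 2 w0)); rewrite mul0r -[RHS]E.
  transitivity ((a1 * (q.1 * w) + b1 * (q.2 * w) + g1 * w) ^+ 2
    + (a2 * (q.1 * w) + b2 * (q.2 * w) + g2 * w) ^+ 2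
    - (a3 * (q.1 * w) + b3 * (q.2 * w) + g3 * w) ^+ 2).
    by rewrite /q /=; ring.
  by rewrite -one expr1n.
set A1 := a1 ^+ 2 + a2 ^+ 2 - a3 ^+ 2 in A3 A6.
have Phi P : (dot (P - K) u / a) ^+ 2 + (dot (P - K) (rot90 u) / b) ^+ 2 - 1 =
    A1 * conic c P.
  transitivity ((a1 * frx P + b1 * frv P + g1 * frw P) ^+ 2
    + (a2 * frx P + b2 * frv P + g2 * frw P) ^+ 2
    - (a3 * frx P + b3 * frv P + g3 * frw P) ^+ 2).
    by rewrite -E3 expr1n E1 E2.
  rewrite /conic.
  transitivity (A1 * frx P ^+ 2
    + 2 * (a1 * b1 + a2 * b2 - a3 * b3) * (frx P * frv P)
    + (b1 ^+ 2 + b2 ^+ 2 - b3 ^+ 2) * frv P ^+ 2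
    + 2 * (a1 * g1 + a2 * g2 - a3 * g3) * (frx P * frw P)
    + 2 * (b1 * g1 + b2 * g2 - b3 * g3) * (frv P * frw P)
    + (g1 ^+ 2 + g2 ^+ 2 - g3 ^+ 2) * frw P ^+ 2); first by rewrite /A1; ring.
  by rewrite A2 A3 A4 A5 A6; ring.
have A10 : A1 != 0.
  apply/eqP => A10; have := Phi K; rewrite A10 mul0r subrr /dot /= !mul0r addr0 !mul0r.
  by rewrite expr0n addr0 sub0r => /eqP; rewrite oppr_eq0 oner_eq0.
move=> P; apply: (mulfI A10); rewrite -!Phi.
have -> : K + K - P - K = - (P - K) by rewrite opprB addrAC addrK.
have dotN v w : dot (- v) w = - dot v w :> R by rewrite /dot /=; ring.
by rewrite !dotN !mulNr !sqrrN.
Qed.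

(** For [theta = pi / 2] the chords are diameters in the chart, all through [chart (0, 0) = K].
    Otherwise any admissible ellipse makes [conic] symmetric about its centre, and uniqueness of [K]
    at its level identifies that centre. *)
Lemma fregier_centerP theta K : 0 < theta < pi ->
  (forall P, conic (cos theta) P = conic (cos theta) K -> P = K) ->
  (cos theta = 0 -> conic (cos theta) K = 0) ->
  (cos theta != 0 -> ellipse_at K [set P | conic (cos theta) P = 0]) ->
  forall K', fregier_center frE M theta K' <-> K' = K.
Proof using B_lt p_gt0 tau_gt0.
move=> th Kmin K0 Kell K'; have [t0 tpi] := andP th.
have s0 : 0 < sin theta by exact: sin_gt0_pi.
have cs : cos theta ^+ 2 + sin theta ^+ 2 = 1 by exact: cos2Dsin2.
rewrite /fregier_center /fregier_ellipse; case: eqVneq => [tE|tn].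
  have c0 : cos theta = 0 by rewrite tE cos_pihalf.
  rewrite c0 in Kmin K0 cs; rewrite {}c0 in Kell.
  have conic0 P : frx P = 0 -> frv P = 0 -> P = K.
    move=> x0 v0; apply: Kmin; rewrite K0// /conic x0 v0.
    by rewrite !expr0n /= mul0r addr0 subrr.
  have zz : chart (0, 0) = K.
    have d0 : den (0, 0) != 0.
      by apply/lt0r_neq0/den_gt0; rewrite /= expr0n addr0 ler01.
    by apply: conic0; rewrite ?frx_chart ?frv_chart// mul0r.
  split=> [[S [_ HS]]|->].
    have line (e : R * R) : unitv e -> e.2 < 0 -> frx K' * e.1 + frv K' * e.2 = 0.
      move=> ue lt.
      have := HS (chord (cos theta) (sin theta) e).
      rewrite tE cos_pihalf sin_pihalf -/(chord _ _ _) => HS'.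
      rewrite -[RHS](mul0r (frw K')); apply: (chord_line (t := 1)) => //.
        by rewrite expr0n expr1n add0r.
      apply: HS'; rewrite -tE -[X in chord X](cos_pihalf R) -tE.
      apply: chords_chord => //; first by rewrite tE cos_pihalf.
      by left; rewrite tE sin_pihalf.
    (* Two distinct diameters determine the point; the normals [(0, -1)] and [(3/5, -4/5)] are
       rational unit vectors with negative second coordinate. *)
    have l1 : frv K' = 0.
      have := line (0, -1); rewrite /unitv /= sqrrN expr1n expr0n add0r ltrN10.
      by move=> /(_ erefl isT); lra.
    apply: conic0 => //.
    have := line (3 / 5, - (4 / 5)); rewrite /unitv /= l1 => HL.
    have : frx K' * (3 / 5) + 0 * - (4 / 5) = 0 by apply: HL; lra.
    by lra.
  exists [set K]; split=> // cc /chordsP-/(_ th)[e [t [ue lt ht ->]]].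
  have c0 : cos theta = 0 by rewrite tE cos_pihalf.
  have s1 : sin theta = 1 by rewrite tE sin_pihalf.
  have t1 : 0 ^+ 2 + t ^+ 2 = 1 :> R.
    by case: ht => ->; rewrite s1 ?sqrrN expr1n expr0n add0r.
  rewrite c0 -zz; apply: chart_in_chord => //=.
  - by case: ht => ->; rewrite s1 ?oppr_eq0 oner_eq0.
  - by rewrite !mul0r addr0.
  - by rewrite expr0n addr0 ler01.
have c0 : cos theta != 0.
  apply: contra_neq tn => c0.
  by rewrite -[LHS]cosK ?in_itv /= ?ltW// c0 acos0.
split=> [[S [ellS sub]]|->]; last first.
  exists [set P | conic (cos theta) P = 0]; split; first exact: Kell.
  by move=> P /(envelope_sub th) /= E; rewrite /conic E subrr.
have c1 : -1 < cos theta < 1.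
  have : 0 < sin theta ^+ 2 by rewrite exprn_gt0.
  move=> ?; apply/andP; split; nra.
have sym := ellipse_conic_sym c0 c1 ellS.
have {}sym : forall P, conic (cos theta) (K' + K' - P) = conic (cos theta) P.
  by apply: sym => e ue lt; apply: sub; exact: chart_envelope.
(* The reflection of [K] in [K'] lies at the level of [K], hence is [K] itself, so [K' = K]. *)
have := Kmin _ (sym K) => /eqP; rewrite subr_eq => /eqP E.
apply: injective_projections.
  by have := congr1 fst E => /=; lra.
by have := congr1 snd E => /=; lra.
Qed.

End TangentFrame.

(** * Back to the axes of the ellipse *)

Section EllipseFrame.
Context {R : realType} (O u : R * R) (a b : R).
Hypotheses (uu : dot u u = 1) (a0 : 0 < a) (b0 : 0 < b).

Definition ell : set (R * R) :=
  [set P | (dot (P - O) u / a) ^+ 2 + (dot (P - O) (rot90 u) / b) ^+ 2 = 1].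

Definition fregier_ratio (c : R) : R :=
  - ((1 - c ^+ 2) * (b / a + a / b) * (b / a - a / b)
     / (4 + (1 - c ^+ 2) * (b / a - a / b) ^+ 2)).

Lemma dot_ptx x y : dot (frpt O u x y - O) u = x.
Proof using uu.
transitivity (x * dot u u); first by rewrite /frpt /dot /=; ring.
by rewrite uu mulr1.
Qed.

Lemma dot_pty x y : dot (frpt O u x y - O) (rot90 u) = y.
Proof using uu.
transitivity (y * dot u u); first by rewrite /frpt /dot /=; ring.
by rewrite uu mulr1.
Qed.

Lemma pt_dot P : frpt O u (dot (P - O) u) (dot (P - O) (rot90 u)) = P.
Proof using uu.
have u0 : 0 < dot u u by rewrite uu ltr01.
by rewrite -[RHS](frptK O u0) /frx /fry uu !divr1.
Qed.

Lemma dot_ptB P x y :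
  (dot (P - frpt O u x y) u = dot (P - O) u - x) *
  (dot (P - frpt O u x y) (rot90 u) = dot (P - O) (rot90 u) - y).
Proof using uu.
split; [transitivity (dot (P - O) u - x * dot u u)
       |transitivity (dot (P - O) (rot90 u) - y * dot u u)];
  by [rewrite /frpt /dot /=; ring | rewrite uu mulr1].
Qed.

(** * The tangent frame at a given point of the ellipse *)

Section AtPoint.
Variables (m n : R).
Hypothesis mn : m ^+ 2 + n ^+ 2 = 1.
Let M := frpt O u (a * m) (b * n).
(** With [(m, n) = (cos f, sin f)], this is the derivative in [f] of [(a cos f, b sin f)], so
    [rot90 tau] points inwards. Then [p], [B], [h] are read off the equation
    [x^2 + 2 B x y + (1 + 2 h) y^2 = 2 p y] of the ellipse. *)
Let tau := (- (a * n) * u.1 - b * m * u.2, - (a * n) * u.2 + b * m * u.1).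
Let del := b / a - a / b.
Let p := b / a * m ^+ 2 + a / b * n ^+ 2.
Let B := m * n * del.
Let h := del * (b / a * m ^+ 2 - a / b * n ^+ 2) / 2.

Lemma tangent_gt0 : 0 < p /\ 0 < dot tau tau.
Proof using a0 b0 uu mn.
have p0 : 0 < p.
  have [m0|mn0] := eqVneq m 0.
    move: mn; rewrite /p m0 expr0n add0r => ->.
    by rewrite mulr0 add0r mulr1 divr_gt0.
  have k1 : 0 < b / a by exact: divr_gt0.
  have k2 : 0 < a / b by exact: divr_gt0.
  rewrite /p ltr_pwDl//; last by rewrite mulr_ge0 ?sqr_ge0 ?(ltW k2).
  by apply: mulr_gt0 => //; rewrite exprn_even_gt0.
split=> //; have -> : dot tau tau = a * b * p * dot u u.
  by rewrite /p /tau /dot /=; field; rewrite !lt0r_neq0.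
by rewrite uu mulr1; apply: mulr_gt0 p0; exact: mulr_gt0.
Qed.

Lemma tangent_disc : B ^+ 2 < 1 + 2 * h.
Proof using a0 b0 uu mn.
have [p0 _] := tangent_gt0.
rewrite -subr_gt0 (_ : _ - _ = p ^+ 2) ?exprn_gt0//.
have n1 : n ^+ 2 = 1 - m ^+ 2 by rewrite -mn; ring.
have an := lt0r_neq0 a0; have bn := lt0r_neq0 b0.
have -> : B ^+ 2 = m ^+ 2 * n ^+ 2 * del ^+ 2 by rewrite /B; ring.
by rewrite /p /h n1 /del; field; rewrite an bn.
Qed.

Lemma tangent_coord P :
  (dot (P - O) u = a * (m - n * frx M tau P - b / a * m * fry M tau P)) *
  (dot (P - O) (rot90 u) = b * (n + m * frx M tau P - a / b * n * fry M tau P)).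
Proof using a0 b0 uu mn.
have [_ t0] := tangent_gt0.
have an := lt0r_neq0 a0; have bn := lt0r_neq0 b0.
rewrite -{1 4}(frptK M t0 P); move: (frx M tau P) (fry M tau P) => x y.
split.
  transitivity ((a * m - a * n * x - b * m * y) * dot u u).
    by rewrite /frpt /tau /M /dot /=; ring.
  by rewrite uu; field.
transitivity ((b * n + b * m * x - a * n * y) * dot u u).
  by rewrite /frpt /tau /M /dot /=; ring.
by rewrite uu; field.
Qed.

Lemma tangent_frw P : frw M tau p B h P =
  ((b / a + a / b) + del * (m * (dot (P - O) u / a) - n * (dot (P - O) (rot90 u) / b))) / 2.
Proof using a0 b0 uu mn.
have an := lt0r_neq0 a0; have bn := lt0r_neq0 b0.
have n1 : n ^+ 2 = 1 - m ^+ 2 by rewrite -mn; ring.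
rewrite !tangent_coord /frw; move: (frx M tau P) (fry M tau P) => x y.
transitivity ((b / a + a / b + del * (m ^+ 2 - n ^+ 2 - 2 * (m * n) * x
   - (b / a * m ^+ 2 - a / b * n ^+ 2) * y)) / 2).
  by rewrite /B /h /p n1 /del; field; rewrite an bn.
by field; rewrite an bn.
Qed.

(** For [c = 1] this says that [x^2 + v^2 - w^2] is the equation of the ellipse; a general [c] only
    adds [(1 - c^2) w^2]. *)
Lemma tangent_conic c P : conic M tau p B h c P =
  (dot (P - O) u / a) ^+ 2 + (dot (P - O) (rot90 u) / b) ^+ 2 - 1
  + (1 - c ^+ 2) * frw M tau p B h P ^+ 2.
Proof using a0 b0 uu mn.
have an := lt0r_neq0 a0; have bn := lt0r_neq0 b0.
have n1 : n ^+ 2 = 1 - m ^+ 2 by rewrite -mn; ring.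
rewrite /conic /frv !tangent_coord.
suff -> : frx M tau P ^+ 2 + (frw M tau p B h P - fry M tau P) ^+ 2 =
   (a * (m - n * frx M tau P - b / a * m * fry M tau P) / a) ^+ 2
   + (b * (n + m * frx M tau P - a / b * n * fry M tau P) / b) ^+ 2 - 1
   + frw M tau p B h P ^+ 2 by ring.
rewrite /frw; move: (frx M tau P) (fry M tau P) => x y.
transitivity (x ^+ 2 + y ^+ 2 - 2 * y * (p - B * x - h * y) + (p - B * x - h * y) ^+ 2).
  by ring.
congr (_ + _); rewrite /p /h /B /del.
transitivity (m ^+ 2 + n ^+ 2 - 1 + (m ^+ 2 + n ^+ 2) * x ^+ 2
  + (b ^+ 2 / a ^+ 2 * m ^+ 2 + a ^+ 2 / b ^+ 2 * n ^+ 2) * y ^+ 2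
  + 2 * m * n * (b / a - a / b) * x * y - 2 * (b / a * m ^+ 2 + a / b * n ^+ 2) * y).
  by rewrite n1; field; rewrite an bn.
by field; rewrite an bn.
Qed.

Lemma tangent_frE : frE M tau p B h = ell.
Proof using a0 b0 uu mn.
apply/seteqP; split => P /= H.
  have := tangent_conic 1 P; rewrite /conic expr1n subrr mul0r addr0 H mul1r subrr.
  by move/esym/eqP; rewrite subr_eq0 => /eqP.
have := tangent_conic 1 P; rewrite /conic expr1n subrr mul0r addr0 H mul1r subrr.
by move/eqP; rewrite subr_eq0 => /eqP.
Qed.

(** Completing the square: [fregier_ratio] is chosen to cancel the linear terms, and the constant
    simplifies through [sg ^+ 2 = del ^+ 2 + 4]. *)
Lemma tangent_conic_center c P : let K := frpt O u (a * (fregier_ratio c * m))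
    (- (b * (fregier_ratio c * n))) in
  c ^+ 2 <= 1 ->
  conic M tau p B h c P =
  (dot (P - K) u / a) ^+ 2 + (dot (P - K) (rot90 u) / b) ^+ 2
  + (1 - c ^+ 2) * del ^+ 2 / 4
    * (m * (dot (P - K) u / a) - n * (dot (P - K) (rot90 u) / b)) ^+ 2
  - 4 * c ^+ 2 / (4 + (1 - c ^+ 2) * del ^+ 2).
Proof using a0 b0 uu mn.
move=> K c1; rewrite tangent_conic tangent_frw /K !dot_ptB.
have an := lt0r_neq0 a0; have bn := lt0r_neq0 b0.
set sg := b / a + a / b; set s2 := 1 - c ^+ 2.
have D0 : 4 + s2 * del ^+ 2 != 0.
  by rewrite lt0r_neq0// ltr_pwDl// mulr_ge0 ?sqr_ge0// subr_ge0.
have sg2 : sg ^+ 2 = del ^+ 2 + 4 by rewrite /sg /del; field; rewrite an bn.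
have c2 : c ^+ 2 = 1 - s2 by rewrite /s2; ring.
have n1 : n ^+ 2 = 1 - m ^+ 2 by rewrite -mn; ring.
have -> : fregier_ratio c = - (s2 * sg * del / (4 + s2 * del ^+ 2)) by [].
move: (dot (P - O) u) (dot (P - O) (rot90 u)) => X Y.
pose r := - (s2 * sg * del / (4 + s2 * del ^+ 2)); rewrite -/r.
have -> : (X - a * (r * m)) / a = X / a - r * m by field.
have -> : (Y - - (b * (r * n))) / b = Y / b + r * n by field.
move: (X / a) (Y / b) => x y; rewrite c2.
(* This equation for [r] is the vanishing of the linear terms. *)
have E1 : (4 + s2 * del ^+ 2) * r = - (s2 * sg * del) by rewrite /r; field.
transitivity (x ^+ 2 + y ^+ 2 - 1 + s2 / 4 * (sg ^+ 2
  + 2 * sg * del * (m * x - n * y) + del ^+ 2 * (m * x - n * y) ^+ 2)).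
  by field.
transitivity (x ^+ 2 + y ^+ 2 + r ^+ 2 * (m ^+ 2 + n ^+ 2)
  + s2 * del ^+ 2 / 4 * ((m * x - n * y) ^+ 2 + r ^+ 2 * (m ^+ 2 + n ^+ 2) ^+ 2)
  - 2 * r * (m * x - n * y) * (1 + s2 * del ^+ 2 / 4 * (m ^+ 2 + n ^+ 2))
  - 4 * (1 - s2) / (4 + s2 * del ^+ 2)); last by field.
rewrite mn expr1n.
have -> : 2 * r * (m * x - n * y) * (1 + s2 * del ^+ 2 / 4 * 1) =
  (4 + s2 * del ^+ 2) * r * (m * x - n * y) / 2 by field.
rewrite E1.
have -> : r ^+ 2 = s2 ^+ 2 * (del ^+ 2 + 4) * del ^+ 2 / (4 + s2 * del ^+ 2) ^+ 2.
  by rewrite -sg2 /r; field.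
by rewrite sg2; field.
Qed.

(** About [K] the conic is a positive definite form minus the constant [c0]: [K] is its unique
    minimum, and the zero level is an ellipse if [cos theta != 0] and the point [K] if
    [cos theta = 0]. *)
Lemma fregier_center_ellipse theta : 0 < theta < pi ->
  forall K', fregier_center ell M theta K' <->
  K' = frpt O u (a * (fregier_ratio (cos theta) * m))
    (- (b * (fregier_ratio (cos theta) * n))).
Proof using a0 b0 uu mn.
move=> th; rewrite -tangent_frE; set K := frpt _ _ _ _.
have [p0 t0] := tangent_gt0; have disc := tangent_disc.
have an := lt0r_neq0 a0; have bn := lt0r_neq0 b0.
set c := cos theta in K *.
have c1 : c ^+ 2 <= 1 by rewrite -(cos2Dsin2 theta) lerDl sqr_ge0.
pose k := (1 - c ^+ 2) * del ^+ 2 / 4.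
have k0 : 0 <= k by rewrite divr_ge0// mulr_ge0 ?sqr_ge0// subr_ge0.
pose c0 := 4 * c ^+ 2 / (4 + (1 - c ^+ 2) * del ^+ 2).
have E P : conic M tau p B h c P =
  (dot (P - K) u / a) ^+ 2 + (dot (P - K) (rot90 u) / b) ^+ 2
  + k * (m * (dot (P - K) u / a) - n * (dot (P - K) (rot90 u) / b)) ^+ 2 - c0.
  exact: tangent_conic_center.
have EK : conic M tau p B h c K = - c0.
  rewrite E subrr /dot /= !mul0r !addr0 !mul0r !mulr0 subrr.
  by rewrite !expr0n /= mulr0 !add0r.
apply: fregier_centerP => //.
- move=> P; rewrite E EK => H.
  set X := dot (P - K) u / a in H; set Y := dot (P - K) (rot90 u) / b in H.
  have X2 := sqr_ge0 X; have Y2 := sqr_ge0 Y.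
  have Z2 : 0 <= k * (m * X - n * Y) ^+ 2 by rewrite mulr_ge0// sqr_ge0.
  have /eqP : X ^+ 2 = 0 by lra.
  have /eqP : Y ^+ 2 = 0 by lra.
  rewrite !sqrf_eq0 !mulf_eq0 !invr_eq0 (negbTE an) (negbTE bn) !orbF => /eqP y0 /eqP x0.
  have u0 : 0 < dot u u by rewrite uu ltr01.
  rewrite -(frptK K u0 P) -[RHS](frptK K u0) /frx /fry x0 y0 subrr /dot /=.
  by rewrite !(mul0r, addr0).
- move=> c00; have {}c00 : c = 0 := c00.
  by rewrite EK /c0 c00 expr0n mulr0 mul0r oppr0.
move=> cn.
have c00 : 0 < c0.
  apply: divr_gt0; first by apply: mulr_gt0 => //; rewrite exprn_even_gt0.
  by rewrite ltr_pwDl// mulr_ge0 ?sqr_ge0// subr_ge0.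
have -> : [set P | conic M tau p B h c P = 0] =
  [set P | ((1 + k * m ^+ 2) / a ^+ 2) * dot (P - K) u ^+ 2
    + 2 * (- (k * m * n) / (a * b)) * (dot (P - K) u * dot (P - K) (rot90 u))
    + ((1 + k * n ^+ 2) / b ^+ 2) * dot (P - K) (rot90 u) ^+ 2 = c0].
  apply/seteqP; split => P /=; rewrite E => H.
    by move/eqP: H; rewrite subr_eq0 => /eqP <-; field; rewrite an bn.
  by rewrite -H; field; rewrite an bn.
apply: quad_ellipse => //.
  by rewrite divr_gt0 ?exprn_gt0// ltr_pwDl// mulr_ge0 ?sqr_ge0.
rewrite -subr_gt0.
have -> : (1 + k * m ^+ 2) / a ^+ 2 * ((1 + k * n ^+ 2) / b ^+ 2)
   - (- (k * m * n) / (a * b)) ^+ 2 = (1 + k * (m ^+ 2 + n ^+ 2)) / (a * b) ^+ 2.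
  by field; rewrite an bn.
by rewrite mn mulr1 divr_gt0 ?exprn_gt0 ?mulr_gt0// ltr_pwDl.
Qed.

End AtPoint.
End EllipseFrame.

(** * The circular case and the locus *)

Lemma circle_ell {R : realType} (O u : R * R) (a b : R) :
  dot u u = 1 -> 0 < a -> 0 < b -> circle_at O (ell O u a b) <-> a = b.
Proof.
move=> uu a0 b0; have an := lt0r_neq0 a0; have bn := lt0r_neq0 b0.
split=> [[r r0 E]|->].
  have eq x y : (x / a) ^+ 2 + (y / b) ^+ 2 = 1 -> x ^+ 2 + y ^+ 2 = r ^+ 2.
    move=> H; have : ell O u a b (frpt O u x y) by rewrite /ell /= dot_ptx// dot_pty.
    rewrite E /= => <-; rewrite /enorm sqr_sqrtr; last by rewrite /dot -!expr2 addr_ge0 ?sqr_ge0.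
    by rewrite -[LHS]mulr1 -uu /dot /frpt /=; ring.
  (* The vertices [(a, 0)] and [(0, b)] lie at distances [a] and [b] from [O]. *)
  have ea : a ^+ 2 = r ^+ 2.
    by have := eq a 0; rewrite divff// mul0r expr1n expr0n !addr0; apply.
  have eb : b ^+ 2 = r ^+ 2.
    by have := eq 0 b; rewrite divff// mul0r expr1n expr0n !add0r; apply.
  by apply/eqP; rewrite -(@eqrXn2 _ 2)// ?ltW// ea eb.
exists b => //; apply/seteqP; split => P; rewrite /ell /=.
  move=> H; rewrite /enorm -[RHS](ger0_norm (ltW b0)) -sqrtr_sqr; congr Num.sqrt.
  rewrite -[RHS]mulr1 -H -[LHS]mulr1 -uu.
  by rewrite /dot /=; field.
move=> H; have H2 : dot (P - O) (P - O) = b ^+ 2.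
  by rewrite -H /enorm sqr_sqrtr// /dot -!expr2 addr_ge0 ?sqr_ge0.
rewrite !expr_div_n -mulrDl -[RHS](divff (expf_neq0 2 bn)) -{2}H2.
by congr (_ / _); rewrite -[RHS]mulr1 -uu /dot /=; ring.
Qed.

Unset Implicit Arguments.

Theorem proposition3 (R : realType) (E : set (R * R)) (O : R * R) (theta : R)
    (hE : ellipse_at O E) (htheta0 : 0 < theta) (hthetapi : theta < pi) :
  (forall M, E M -> exists! K, fregier_center E M theta K) /\
  (~ circle_at O E -> ellipse_at O (fregier_center_locus E theta)) /\
  (circle_at O E -> fregier_center_locus E theta = [set O]).
Proof.
have [u [a [b [uu a0 b0 EE]]]] := hE.
rewrite -/(ell O u a b) in EE; rewrite {}EE in hE *.
have th : 0 < theta < pi by rewrite htheta0.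
have an := lt0r_neq0 a0; have bn := lt0r_neq0 b0.
set c := cos theta; set r := fregier_ratio a b c.
(* In the axes of [E] the centre is the image of [M] under [(X, Y) -> (r X, - r Y)], a reflection
   followed by a homothety. *)
have center M K : ell O u a b M -> fregier_center (ell O u a b) M theta K <->
    K = frpt O u (r * dot (M - O) u) (- (r * dot (M - O) (rot90 u))).
  move=> hM; have := fregier_center_ellipse O uu a0 b0 hM th K; rewrite -/c -/r.
  rewrite (mulrC a (_ / a)) (mulrC b (_ / b)) !divfK// pt_dot//.
  suff -> : frpt O u (a * (r * (dot (M - O) u / a)))
      (- (b * (r * (dot (M - O) (rot90 u) / b)))) =
    frpt O u (r * dot (M - O) u) (- (r * dot (M - O) (rot90 u))) by [].
  by congr frpt; field.
split.
  move=> M hM; eexists; split; first by apply/(center _ _ hM).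
  by move=> K' /(center _ _ hM) ->.
rewrite circle_ell//; split => [ab|ab].
  have s0 : 0 < sin theta ^+ 2 by rewrite exprn_gt0// sin_gt0_pi.
  have s2 : 1 - c ^+ 2 = sin theta ^+ 2 by rewrite -(cos2Dsin2 theta) /c; ring.
  (* The only factor of [r] that can vanish is [b / a - a / b = (b - a) (b + a) / (a b)]. *)
  have rn : r != 0.
    rewrite oppr_eq0 mulf_neq0//; last first.
      by rewrite invr_neq0// lt0r_neq0// ltr_pwDl// s2 mulr_ge0 ?sqr_ge0.
    rewrite s2; apply: mulf_neq0.
      by apply: mulf_neq0; rewrite lt0r_neq0// addr_gt0// divr_gt0.
    rewrite (_ : _ - _ = (b - a) * (b + a) / (a * b)); last by field; rewrite an bn.
    rewrite !mulf_neq0 ?invr_neq0 ?mulf_neq0//.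
      by rewrite subr_eq0; apply/eqP => ba; apply: ab.
    by rewrite lt0r_neq0// addr_gt0.
  (* The locus is the image of [E] under this similarity; [r] may be negative, hence the absolute
     values. *)
  exists u, (`|r| * a), (`|r| * b); split => //; rewrite ?mulr_gt0 ?normr_gt0//.
  have nn x y : (x / (`|r| * y)) ^+ 2 = (x / (r * y)) ^+ 2.
    by rewrite !expr_div_n !exprMn real_normK ?num_real.
  apply/seteqP; split => P /=; rewrite !nn.
    move=> [M hM /(center _ _ hM) ->]; rewrite dot_ptx// dot_pty// -[RHS]hM.
    by field; rewrite an bn rn.
  move=> H; pose M := frpt O u (dot (P - O) u / r) (- (dot (P - O) (rot90 u) / r)).
  have hM : ell O u a b M.
    by rewrite /ell /= dot_ptx// dot_pty// -[RHS]H; field; rewrite an bn rn.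
  exists M => //; apply/(center _ _ hM); rewrite /M dot_ptx// dot_pty//.
  rewrite -[LHS](pt_dot O uu); congr frpt; field => //.
have r0 : r = 0 by rewrite /r /fregier_ratio ab divff// subrr mulr0 mul0r oppr0.
have center0 M K : ell O u a b M -> fregier_center (ell O u a b) M theta K <-> K = O.
  move=> /center ->; rewrite r0 !mul0r oppr0 /frpt !mul0r !addr0 subr0.
  by rewrite -surjective_pairing.
apply/seteqP; split => [K [M hM /(center0 _ _ hM)]//|K /= ->].
(* A point of [E], here a vertex, shows that [O] is attained. *)
have hM : ell O u a b (frpt O u a 0).
  by rewrite /ell /= dot_ptx// dot_pty// divff// mul0r expr1n expr0n addr0.
by exists (frpt O u a 0) => //; apply/(center0 _ _ hM).
Qed.
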